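(* There exists an algorithm that, given a semi-complete digraph $T$ and an integer $k$, in time $O(2^{O(k\log k)}|V(T)|^2)$ computes a path decomposition of $T$ of width at most $k$, or correctly concludes that no such decomposition exists.
   Context: All digraphs are simple. A digraph $T$ is semi-complete if for every two distinct vertices $v,w$ at least one of the arcs $(v,w)$, $(w,v)$ is present. A path decomposition of a digraph $G=(V,E)$ is a sequence $(W_1,\dots,W_r)$ of subsets of $V$ such that (i) $\bigcup_i W_i=V$; (ii) $W_i\cap W_k\subseteq W_j$ for $1\le i<j<k\le r$; (iii) for every arc $(u,v)\in E$, either $u,v\in W_i$ for some $i$, or $u\in W_i$, $v\in W_j$ for some $i>j$. Its width is $\max_i(|W_i|-1)$. *)

(* Defs.v *)
From HB Require Import structures.
From mathcomp Require Import all_boot all_order all_algebra.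
Set Implicit Arguments.
Unset Strict Implicit.
Unset Printing Implicit Defensive.
Import Order.TTheory GRing.Theory Num.Theory.

(* A simple digraph on V is an irreflexive relation: loops are excluded and
   parallel arcs cannot be expressed, but a pair of opposite arcs is allowed. *)

Definition semi_complete (V : finType) (e : rel V) : Prop :=
  forall v w : V, v != w -> e v w || e w v.

(* Positions are numbered from 0.  In the last clause the tail u of a backward
   arc lies in the later bag. *)
Definition path_decomposition (V : finType) (e : rel V) (D : seq {set V}) : Prop :=
  [/\ \bigcup_(W <- D) W = [set: V],
      forall i j l : nat, i < j -> j < l -> l < size D ->
        nth set0 D i :&: nth set0 D l \subset nth set0 D j
    & forall u v : V, e u v ->
        (exists i : nat,
           [/\ i < size D, u \in nth set0 D i & v \in nth set0 D i]) \/
        (exists i j : nat,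
           [/\ j < i, i < size D, u \in nth set0 D i & v \in nth set0 D j])].

(* The maximum of the #|W| - 1, an integer that is -1 if all bags are empty
   (in particular for the empty sequence). *)
Definition width (V : finType) (D : seq {set V}) : int :=
  ((\max_(W <- D) #|W|)%:Z - 1)%R.

(* Model of computation: structured programs for a word RAM, with integer
   registers indexed by nat, of which a program uses finitely many, and a memory
   indexed by int.  A word is an integer of absolute value less than 2 ^ w; a
   computation that produces any other value is stuck.  Every constant, register
   access, memory access, arithmetic operation and test takes one time unit. *)

Inductive binop := Add | Sub | Mul | Div.

Inductive expr :=
  | Const of int
  | Reg of nat
  | Read of expr
  | Op of binop & expr & expr.

(* The condition of If and While is that the value of the first expression is at
   most the value of the second one. *)
Inductive cmd :=
  | Skip
  | Assign of nat & expr
  | Write of expr & expr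
  | Seq of cmd & cmd
  | If of expr & expr & cmd & cmd
  | While of expr & expr & cmd.

Record state := State { regs : nat -> int; memory : int -> int }.

Definition upd (T : eqType) (f : T -> int) (a : T) (x : int) : T -> int :=
  fun b => if b == a then x else f b.

Definition eval_op (o : binop) (x y : int) : int :=
  match o with
  | Add => (x + y)%R
  | Sub => (x - y)%R
  | Mul => (x * y)%R
  | Div => (x %/ y)%Z
  end.

Fixpoint eval (s : state) (a : expr) : int :=
  match a with
  | Const z => z
  | Reg r => regs s r
  | Read b => memory s (eval s b)
  | Op o b1 b2 => eval_op o (eval s b1) (eval s b2)
  end.

Fixpoint cost (a : expr) : nat :=
  match a with
  | Const _ | Reg _ => 1
  | Read b => (cost b).+1
  | Op _ b1 b2 => (cost b1 + cost b2).+1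
  end.

Definition word (w : nat) (z : int) : bool := `|z|%N < 2 ^ w.

(* All intermediate values in the evaluation of a are words. *)
Fixpoint fits (w : nat) (s : state) (a : expr) : bool :=
  word w (eval s a) &&
  match a with
  | Const _ | Reg _ => true
  | Read b => fits w s b
  | Op _ b1 b2 => fits w s b1 && fits w s b2
  end.

(* exec w p s t s': with word length w, the program p started in state s halts
   in state s' after t time units. *)
Inductive exec (w : nat) : cmd -> state -> nat -> state -> Prop :=
  | exec_skip s : exec w Skip s 1 s
  | exec_assign s r a : fits w s a ->
      exec w (Assign r a) s (cost a).+1 (State (upd (regs s) r (eval s a)) (memory s))
  | exec_write s a b : fits w s a -> fits w s b ->
      exec w (Write a b) s (cost a + cost b).+1
        (State (regs s) (upd (memory s) (eval s a) (eval s b)))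
  | exec_seq s t1 s1 t2 s2 p q :
      exec w p s t1 s1 -> exec w q s1 t2 s2 ->
      exec w (Seq p q) s (t1 + t2) s2
  | exec_if s t s1 a b p q : fits w s a -> fits w s b ->
      exec w (if (eval s a <= eval s b)%R then p else q) s t s1 ->
      exec w (If a b p q) s (cost a + cost b + t).+1 s1
  | exec_while_end s a b p : fits w s a -> fits w s b ->
      ~~ (eval s a <= eval s b)%R ->
      exec w (While a b p) s (cost a + cost b).+1 s
  | exec_while_loop s t1 s1 t2 s2 a b p : fits w s a -> fits w s b ->
      (eval s a <= eval s b)%R ->
      exec w p s t1 s1 -> exec w (While a b p) s1 t2 s2 ->
      exec w (While a b p) s (cost a + cost b + t1 + t2).+1 s2.

(* Initially register 0 holds n, register 1 holds k, and the addresses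
   0, ..., n ^ 2 - 1 hold the adjacency matrix of e, row by row; all other
   registers and memory cells are 0. *)
Definition input (n : nat) (e : rel 'I_n) (k : int) : state :=
  State (nth 0 [:: n%:Z; k])%R
        (fun a => if [exists i : 'I_n, exists j : 'I_n,
                        (a == (i * n + j)%N%:Z)%R && e i j]
                  then 1%R else 0%R).

(* The bags as a sequence of numbers: the number of bags, and then each bag as
   its number of elements followed by its elements. *)
Definition encoding (n : nat) (L : seq (seq 'I_n)) : seq nat :=
  size L :: flatten [seq size b :: [seq val x | x <- b] | b <- L].

(* Register 1 holds the address from which on the encoding of D is stored; the
   elements of a bag may be listed in any order, but without repetition. *)
Definition outputs (n : nat) (s : state) (D : seq {set 'I_n}) : Prop :=
  exists L : seq (seq 'I_n),
    [/\ all uniq L,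
        D = [seq [set x in b] | b <- L]
      & forall i : nat, i < size (encoding L) ->
          memory s (regs s 1 + i%:Z)%R = Posz (nth 0 (encoding L) i)].

(* Register 0 holds the answer: 1 for a decomposition, 0 for nonexistence. *)
Definition correct_answer (n : nat) (e : rel 'I_n) (k : int) (s : state) : Prop :=
  (regs s 0 = 1%R /\
   exists D : seq {set 'I_n},
     [/\ outputs s D, path_decomposition e D & (width D <= k)%R]) \/
  (regs s 0 = 0%R /\
   ~ exists D : seq {set 'I_n}, path_decomposition e D /\ (width D <= k)%R).

(* |k| log |k|, with the binary logarithm rounded up (0 for |k| <= 1). *)
Definition klogk (k : int) : nat := `|k|%N * up_log 2 `|k|%N.

(* Main.v *)
(** Let N v be the closed out-neighbourhood of v, and call core X the set of the v
    with N v inside X.  Read a path decomposition from left to right and let X be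
    the set of vertices introduced so far; once a vertex of core X is introduced it
    may be forgotten.  Up to normalisation every step picks a vertex v and replaces
    X by X' = X :|: N v, with the bag X' :\: core X, so that the width is at most k
    iff the full set can be reached from the empty set by steps whose bags have at
    most k + 1 elements.

    In a semi-complete digraph, if U is the complement of X, no arc leads from
    core X to U, hence all arcs from U to core X are present.  For two reachable
    sets X, X0 this makes core X :\: X0 or core X0 :\: X empty.  If moreover X and
    X0 have almost the same size, then these differences consist of vertices of
    low degree in the complement or in the core of X0, of which there are O(k),
    and together with the trace of X on the boundary of X0 they determine X.
    So if the width is at most k, there are at most 2 ^ (10 k) reachable sets of
    each size.

    The program therefore explores the reachable sets breadth first, storing with
    X the numbers |N v :\: X|, and drops new sets of a size that has already
    occurred 2 ^ (10 k) times.  Each set has only O(k) admissible steps, each of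
    which takes time O(n) times a function of k. *)

Require Import Defs.
From HB Require Import structures.
From mathcomp Require Import all_boot all_order all_algebra.
From mathcomp Require Import zify.
Set Implicit Arguments.
Unset Strict Implicit.
Unset Printing Implicit Defensive.
Import Order.TTheory GRing.Theory Num.Theory.

(** * Reachable sets *)

Section Graph.
Variables (V : finType) (e : rel V).
Implicit Types (X F : {set V}) (u v w : V) (D : seq {set V}).

Definition nbh v : {set V} := [set u | (u == v) || e v u].
Definition core X : {set V} := [set v | nbh v \subset X].
Definition dfc X v : nat := #|nbh v :\: X|.
(** By [card_bag] the sum is the size of the bag [(X :|: nbh v) :\: core X] of the step; positivity
    of [dfc X v] says that the step enlarges [X]. *)
Definition admissible k X v : bool :=
  (0 < dfc X v) && (#|X :\: core X| + dfc X v <= k.+1).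

Lemma nbh_refl v : v \in nbh v.
Proof. by rewrite inE eqxx. Qed.

Lemma core_sub X : core X \subset X.
Proof.
by apply/subsetP=> v; rewrite inE => /subsetP; apply; apply: nbh_refl.
Qed.

Lemma coreS (X Y : {set V}) : X \subset Y -> core X \subset core Y.
Proof. by move=> h; apply/subsetP=> v; rewrite !inE => /subset_trans; apply. Qed.

Lemma dfc_eq0 X v : (dfc X v == 0) = (v \in core X).
Proof. by rewrite /dfc cards_eq0 setD_eq0 inE. Qed.

Lemma core_setT : core setT = setT.
Proof. by apply/setP=> v; rewrite !inE subsetT. Qed.

Lemma core_set0 : core set0 = set0.
Proof. by apply/eqP; rewrite -subset0 core_sub. Qed.

Lemma card_step X v : #|X :|: nbh v| = #|X| + dfc X v.
Proof.
rewrite -(cardsID X (X :|: nbh v)) setDUl setDv set0U.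
by rewrite (setIidPr (subsetUl _ _)).
Qed.

Lemma card_bag X v :
  #|(X :|: nbh v) :\: core X| = #|X :\: core X| + dfc X v.
Proof.
have h : core X \subset X :|: nbh v by apply: subset_trans (core_sub X) (subsetUl _ _).
rewrite !cardsD (setIidPr h) (setIidPr (core_sub X)) card_step.
have := subset_leq_card (core_sub X); lia.
Qed.

(** * From a sequence of admissible steps to a path decomposition *)

Inductive leads k : {set V} -> seq {set V} -> Prop :=
  | leads_nil : leads k setT [::]
  | leads_cons X v D : admissible k X v -> leads k (X :|: nbh v) D ->
      leads k X (((X :|: nbh v) :\: core X) :: D).

Lemma leads_card k X D W : leads k X D -> W \in D -> #|W| <= k.+1.
Proof.
elim=> [|{}X v {}D /andP[_ adm] _ IH]; first by rewrite in_nil.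
by rewrite in_cons => /orP[/eqP->|//]; rewrite card_bag.
Qed.

Lemma leads_cover k X D u : leads k X D -> u \notin core X ->
  exists2 W, W \in D & u \in W.
Proof.
elim=> [|{}X v {}D _ _ IH]; first by rewrite core_setT inE.
move=> uX; case: (boolP (u \in X :|: nbh v)) => uX'.
  by exists ((X :|: nbh v) :\: core X); rewrite ?mem_head // inE uX.
have [|W WD uW] := IH; last by exists W; rewrite // in_cons WD orbT.
by apply: contra uX'; apply/subsetP/core_sub.
Qed.

Lemma leads_ncore k X D u i : leads k X D -> u \in nth set0 D i -> u \notin core X.
Proof.
move=> H; elim: H i => [|{}X v {}D _ _ IH] i; first by rewrite nth_nil inE.
case: i => [|i] /=; first by rewrite inE => /andP[].
by move/IH; apply/contra/subsetP/coreS/subsetUl.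
Qed.

(** After its introduction a vertex stays in every bag until it has entered the core, and by
    [leads_ncore] it occurs in no bag afterwards. *)
Lemma leads_convex k X D u j l : leads k X D -> u \in X ->
  u \in nth set0 D l -> j <= l -> u \in nth set0 D j.
Proof.
move=> H; elim: H j l => [|{}X v {}D adm Hl IH] j l uX; first by rewrite nth_nil inE.
move=> ul jl; have uc := leads_ncore (leads_cons adm Hl) ul.
case: j jl => [|j] jl /=; first by rewrite in_setD uc in_setU uX.
case: l ul jl => [|l] //= ul jl.
by apply: IH ul _; rewrite // inE uX.
Qed.

(** The third alternative is for the induction: the head was introduced before [D] starts, so its
    bag lies further left. It cannot occur for [X = set0]. *)
Lemma leads_arc k X D u v : leads k X D -> e u v -> u \notin core X ->
  [\/ exists i, [/\ i < size D, u \in nth set0 D i & v \in nth set0 D i],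
      exists i j, [/\ j < i, i < size D, u \in nth set0 D i & v \in nth set0 D j]
    | v \in X /\ exists2 i, i < size D & u \in nth set0 D i].
Proof.
move=> H uv; elim: H => [|{}X x {}D _ _ IH]; first by rewrite core_setT inE.
(* If [u] enters the core in this step, its out-neighbours all lie in the new set, so [v] is in the
   first bag too unless it has already entered [core X]. *)
move=> uc; case: (boolP (u \in core (X :|: nbh x))) => uc'.
  have u0 : u \in (X :|: nbh x) :\: core X.
    by rewrite inE uc; move: uc'; apply/subsetP/core_sub.
  have vX' : v \in X :|: nbh x.
    by move: uc'; rewrite inE => /subsetP; apply; rewrite inE uv orbT.
  case: (boolP (v \in core X)) => vc; last first.
    by constructor 1; exists 0; split=> //=; rewrite inE vc.
  by constructor 3; split; [move: vc; apply/subsetP/core_sub | exists 0].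
case: (IH uc') => [[i [? ? ?]]|[i [j [? ? ? ?]]]|[vX' [i ? ?]]].
- by constructor 1; exists i.+1.
- by constructor 2; exists i.+1, j.+1.
- case: (boolP (v \in X)) => vX; first by constructor 3; split; [|exists i.+1].
  constructor 2; exists i.+1, 0; split=> //=.
  by rewrite inE vX' andbT; apply: contra vX; apply/subsetP/core_sub.
Qed.

Lemma leads_interval k X D i j l : leads k X D -> i < j -> j < l -> l < size D ->
  nth set0 D i :&: nth set0 D l \subset nth set0 D j.
Proof.
move=> H; elim: H i j l => [|{}X v {}D adm Hl IH] [|i] [|j] [|l] //= ij jl ls.
  apply/subsetP=> u; rewrite !inE => /andP[/andP[_ uX] ul].
  by apply: leads_convex Hl _ ul (ltnW jl); rewrite !inE.
exact: IH.
Qed.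

Lemma leads_path_decomposition k D : leads k set0 D -> path_decomposition e D.
Proof.
move=> H; split.
- apply/setP=> u; rewrite [RHS]inE bigcup_seq; apply/bigcupP.
  have [|W WD uW] := leads_cover H (u := u); first by rewrite core_set0 inE.
  by exists W.
- by move=> i j l; apply: leads_interval H.
move=> u v uv; have [|||] := leads_arc H uv; first by rewrite core_set0 inE.
- by left.
- by right.
- by case; rewrite inE.
Qed.

Lemma width_leP D (k : nat) :
  (width D <= k%:Z)%R <-> (forall W, W \in D -> #|W| <= k.+1).
Proof.
rewrite /width; split=> [h W WD|h].
  have := @leq_bigmax_seq _ D xpredT (fun W : {set V} => #|W|) W WD isT; move=> /= ?; lia.
suff: \max_(W <- D) #|W| <= k.+1 by lia.
by apply/bigmax_leqP_seq=> W WD _; apply: h.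
Qed.

(** * From a path decomposition to a sequence of admissible steps *)

Section Complete.
Variables (k : nat) (D : seq {set V}).
Hypotheses (pD : path_decomposition e D) (wD : forall W, W \in D -> #|W| <= k.+1).

(** The index of the last bag containing [u]. The value 0 of an empty maximum causes no ambiguity,
    since every vertex is covered ([lstP]). *)
Let lst u := \max_(i < size D | u \in nth set0 D i) i.

Lemma lst_ge u i : i < size D -> u \in nth set0 D i -> i <= lst u.
Proof. by move=> iD ui; apply: (@leq_bigmax_cond _ _ _ (Ordinal iD)). Qed.

Lemma lstP u : lst u < size D /\ u \in nth set0 D (lst u).
Proof.
case: pD => [cov _ _]; have : u \in [set: V] by rewrite inE.
rewrite -cov bigcup_seq => /bigcupP[W WD uW].
have iD : index W D < size D by rewrite index_mem.
have := @eq_bigmax_cond _ (fun i : 'I_(size D) => u \in nth set0 D i) (fun i => i : nat).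
case=> [|i ui E]; first by apply/card_gt0P; exists (Ordinal iD); rewrite unfold_in /= nth_index.
by rewrite /lst E.
Qed.

Lemma nbh_before u w : w \in nbh u -> exists2 j, j <= lst u & w \in nth set0 D j.
Proof.
rewrite inE => /orP[/eqP->|uw]; first by exists (lst u); case: (lstP u).
case: pD => _ _ /(_ u w uw) [[i [iD ui wi]]|[i [j [ji iD ui wj]]]].
  by exists i => //; apply: lst_ge.
by exists j => //; apply: leq_trans (ltnW ji) (lst_ge iD ui).
Qed.

(** Taking the vertices in the order of their last bags gives admissible steps, because each new bag
    is contained in the last bag of the vertex taken. As an induction principle over [Q] this serves
    both [level_ref] and [closed_goal]. *)
Lemma reach_setT (Q : {set V} -> Prop) :
  Q set0 -> (forall X v, Q X -> admissible k X v -> Q (X :|: nbh v)) -> Q setT.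
Proof.
move=> Q0 Qs.
(* [F] is the set of vertices taken so far, an initial segment for [lst]; the current set is the
   union of their closed out-neighbourhoods. *)
suff main m F : #|~: F| = m -> (forall x y, x \in F -> y \notin F -> lst x <= lst y) ->
    Q (\bigcup_(x in F) nbh x) -> Q setT.
  by apply: (main _ set0 erefl) => [x y|]; rewrite ?inE // big_set0.
elim: m F => [|m IH] F cF Fd QF.
  move/eqP: cF; rewrite cards_eq0 => /eqP cF.
  have FT : F = setT by rewrite -[F]setCK cF setC0.
  suff <- : \bigcup_(x in F) nbh x = setT by [].
  apply/setP=> x; rewrite [RHS]inE; apply/bigcupP; exists x; rewrite ?FT ?inE //.
  by rewrite eqxx.
have [v0 v0F] : exists v0, v0 \notin F.
  by case/card_gt0P: (eq_ind_r (fun c => 0 < c) (ltn0Sn m) cF) => x; rewrite inE; exists x.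
case: (@arg_minnP _ v0 (fun x => x \notin F) lst v0F) => v vF vmin.
have EU : \bigcup_(x in v |: F) nbh x = (\bigcup_(x in F) nbh x) :|: nbh v.
  by rewrite bigcup_setU big_set1 setUC.
apply: (IH (v |: F)).
- by rewrite setCU setIC -setDE; have := cardsD1 v (~: F); rewrite inE vF cF; lia.
- move=> x y; rewrite !inE negb_or => /orP[/eqP->|xF] /andP[_ yF]; last exact: Fd.
  exact: vmin.
rewrite EU; set X := \bigcup_(x in F) nbh x in QF EU *.
case: (boolP (v \in core X)) => vX.
  by move: vX; rewrite inE => /setUidPl ->.
apply: Qs QF _; rewrite /admissible lt0n dfc_eq0 vX /= -card_bag.
have [lD vl] := lstP v.
apply: leq_trans (wD (mem_nth set0 lD)); apply: subset_leq_card.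
apply/subsetP=> w; rewrite inE => /andP[wc].
(* As [w] has not been taken, its last bag is not before that of [v]; by [nbh_before] some bag not
   after that of [v] contains it. Convexity then puts [w] into bag [lst v], the cases of equality
   being treated separately. *)
have wF : w \notin F.
  by apply: contra wc => wF; rewrite inE; apply: bigcup_sup.
rewrite -EU => /bigcupP[x]; rewrite in_setU1 => xF wx.
have [j jx wj] := nbh_before wx.
have jv : j <= lst v.
  apply: leq_trans jx _; case/orP: xF => [/eqP->//|xF]; exact: Fd.
have [lwD wl] := lstP w; have vw := vmin _ wF.
have [E|vw'] := eqVneq (lst v) (lst w); first by rewrite E.
have [E|jv'] := eqVneq j (lst v); first by rewrite -E.
case: pD => _ cvx _; apply: (subsetP (cvx j (lst v) (lst w) _ _ lwD)); last by rewrite inE wj.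
  by rewrite ltn_neqAle jv'.
by rewrite ltn_neqAle vw'.
Qed.
End Complete.

(** * The number of good sets of a given size *)

Definition good k X : bool :=
  (X == \bigcup_(v in core X) nbh v) && (#|X :\: core X| <= k).

Lemma good0 k : good k set0.
Proof. by rewrite /good core_set0 big_set0 eqxx setDv cards0. Qed.

(** A bag may have [k + 1] elements, but [v] lies in it and enters the core, so the new boundary is
    a proper subset of the bag and has at most [k]. *)
Lemma good_step k X v : good k X -> admissible k X v -> good k (X :|: nbh v).
Proof.
move=> /andP[/eqP EX cX] /andP[dv bv]; apply/andP; split.
  rewrite eqEsubset; apply/andP; split; last first.
    by apply/bigcupsP=> x; rewrite inE.
  rewrite subUset; apply/andP; split; last first.
    by apply: bigcup_sup; rewrite inE subsetUr.
  rewrite {1}EX; apply/bigcupsP=> x xc; apply: bigcup_sup.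
  by move: xc; apply/subsetP/coreS/subsetUl.
rewrite -ltnS; apply: leq_trans bv; rewrite -card_bag; apply: proper_card.
apply/properP; split; first by apply: setDS; apply/coreS/subsetUl.
exists v; first by rewrite in_setD -dfc_eq0 -lt0n dv in_setU nbh_refl orbT.
by rewrite in_setD inE subsetUr.
Qed.

(** A step adds at most [k + 1] vertices, so the sequence of steps may jump over size [m], but only
    to a size of at most [m + k]. *)
Lemma level_ref k D m : path_decomposition e D ->
  (forall W, W \in D -> #|W| <= k.+1) -> m <= #|V| ->
  exists X0, [/\ good k X0, m <= #|X0| & #|X0| <= m + k].
Proof.
move=> pD wD mV.
pose Q X := good k X /\ (m <= #|X| -> exists X0, [/\ good k X0, m <= #|X0| & #|X0| <= m + k]).
suff: Q setT by case=> _; apply; rewrite cardsT.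
apply: (reach_setT pD wD) => [|X v [gX IH] adm].
  split; first exact: good0.
  by rewrite cards0 => m0; exists set0; rewrite cards0 good0 m0.
split; first exact: good_step.
have [mX _|mX mX'] := leqP m #|X|; first exact: IH.
exists (X :|: nbh v); split=> //; first exact: good_step.
case/andP: adm => _; rewrite card_step; lia.
Qed.

Hypothesis sc : semi_complete e.

(* Both the out-degree and the in-degree version are needed, hence the abstract
   relation [r]. *)
Lemma low_degree (r : rel V) (A : {set V}) d :
  (forall x y, r x y || r y x) ->
  #|[set x in A | #|[set y in A | r x y]| <= d]| <= d.*2.
Proof.
move=> rT; set H := [set x in A | _].
have h1 : \sum_(x in H) \sum_(y in H) r x y <= \sum_(x in H) d.
  apply: leq_sum => x; rewrite inE => /andP[_]; apply: leq_trans.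
  rewrite -sum1_card big_mkcond [X in _ <= X]big_mkcond /=.
  by apply: leq_sum => y _; rewrite !inE; case: (y \in A); case: (r x y); case: (_ <= d).
(* Every ordered pair, the diagonal included, is related in at least one direction, and exchanging
   the sums counts both. With [h1] this bounds [#|H| ^ 2] by [2 * d * #|H|]. *)
have h2 : #|H| * #|H| <= (\sum_(x in H) \sum_(y in H) r x y).*2.
  rewrite -addnn {2}exchange_big /= -big_split /= -sum_nat_const.
  apply: leq_sum => x _; rewrite -big_split /= -sum1_card; apply: leq_sum => y _.
  by have := rT x y; case: (r x y); case: (r y x).
rewrite sum_nat_const in h1.
have [->//|H0] := posnP #|H|; rewrite -(leq_pmul2l H0); lia.
Qed.

(** For fixed [X0] these four sets determine [core X], and with it a good [X]. The first two live on
    the boundary of [X0], the last two record where [X] departs from [X0]. *)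
Definition reference_trace (X0 X : {set V}) :=
  (core X :&: (X0 :\: core X0), (X0 :\: core X0) :\: X, core X :\: X0, core X0 :\: X).

(** A vertex of [core X] outside [X0] or on its boundary is read off a component. One in [core X0]
    has its out-neighbours in [X0], and any of them missing from [Y] would show in the second or the
    fourth component. *)
Lemma reference_trace_core (X0 X Y : {set V}) :
  reference_trace X0 X = reference_trace X0 Y -> core X \subset core Y.
Proof.
case=> EB EU ES EL; apply/subsetP=> v vX.
case: (boolP (v \in X0)) => v0; last first.
  by have : v \in core X :\: X0; [rewrite inE v0 | rewrite ES inE => /andP[]].
case: (boolP (v \in core X0)) => vc; last first.
  have : v \in core X :&: (X0 :\: core X0) by rewrite in_setI vX in_setD vc.
  by rewrite EB in_setI => /andP[].
rewrite inE; apply/subsetP=> w wv; apply: contraT => wY.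
have wX : w \in X by move: vX; rewrite inE => /subsetP; apply.
have w0 : w \in X0 by move: vc; rewrite inE => /subsetP; apply.
case: (boolP (w \in core X0)) => wc.
  by have : w \in core X0 :\: Y; [rewrite inE wY | rewrite -EL inE wX].
have : w \in (X0 :\: core X0) :\: Y by rewrite !in_setD wY wc.
by rewrite -EU !in_setD wX.
Qed.

Lemma semi_complete_nbh x y : (y \in nbh x) || (x \in nbh y).
Proof.
rewrite !inE (eq_sym y); have [//|xy] := eqVneq x y.
by have := sc xy.
Qed.

(* Two separations of bounded order are crossing-free up to their boundaries,
   and one of equal size to [X0] differs from it only by few vertices of low
   degree in [core X0] or in the complement of [X0]. *)
Lemma card_good k X0 : good k X0 ->
  #|[set X | [&& good k X, #|X| <= #|X0| & #|X0| <= #|X| + k]]| <= 2 ^ (10 * k).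
Proof.
move=> /andP[_ cB0]; set G := [set X | _].
(* The threshold [2 k] comes from [X0 :\: core X], of size at most [#|X| + k - #|core X|] when
   [core X] lies in [X0]. *)
pose Lo := [set x in core X0 | #|[set y in core X0 | x \in nbh y]| <= k.*2].
pose Hi := [set x in ~: X0 | #|[set y in ~: X0 | y \in nbh x]| <= k.*2].
have cLo : #|Lo| <= k.*2.*2.
  by apply: (low_degree (r := fun x y => x \in nbh y)) => x y; rewrite orbC semi_complete_nbh.
have cHi : #|Hi| <= k.*2.*2.
  by apply: (low_degree (r := fun x y => y \in nbh x)) => x y; apply: semi_complete_nbh.
pose B0 := X0 :\: core X0.
have inj : {in G &, injective (reference_trace X0)}.
  move=> X Y; rewrite !inE => /andP[/andP[/eqP EX _] _] /andP[/andP[/eqP EY _] _] E.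
  suff EC : core X = core Y by rewrite EX EY EC.
  by apply/eqP; rewrite eqEsubset !(@reference_trace_core X0).
rewrite -(card_in_imset inj).
apply: (@leq_trans #|setX (setX (setX (powerset B0) (powerset B0)) (powerset Hi)) (powerset Lo)|);
  last first.
  (* The exponent is [k + k] for two subsets of the boundary plus [4 k + 4 k] for the subsets of
     [Hi] and [Lo]. *)
  rewrite !cardsX !card_powerset -!expnD leq_exp2l //; rewrite -/B0 in cB0; lia.
apply: subset_leq_card; apply/subsetP=> tr /imsetP[X]; rewrite inE => /and3P[gX X1 X2] ->{tr}.
rewrite !in_setX !powersetE subsetIr subsetDl /=.
(* An arc from [x] to [y] would force [y] into [X], one from [y] to [x] would force [x] into [X0].
   So one of the last two components of the trace is empty. *)
have cross x y : x \in core X :\: X0 -> y \in core X0 :\: X -> false.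
  rewrite !in_setD !(in_set (fun v => nbh v \subset _)).
  move=> /andP[x0 /subsetP xX] /andP[yX /subsetP y0].
  by have /orP[/xX|/y0] := semi_complete_nbh x y; rewrite ?(negPf x0) ?(negPf yX).
case/andP: gX => _ cB.
have [L0|[y yL]] := set_0Vmem (core X0 :\: X).
  rewrite L0 sub0set andbT; apply/subsetP=> x xS.
  move: (xS); rewrite !inE => /andP[x0 xX]; rewrite x0 /=.
  have s0X : core X0 \subset X by rewrite -setD_eq0 L0.
  (* As [x] is in [core X], its out-neighbours lie in [X], and those outside [X0] avoid [core X0].
     The other case is dual: since [u] is not in [X], no vertex with [u] in its neighbourhood is in
     [core X]. *)
  have h : [set y in ~: X0 | y \in nbh x] \subset X :\: core X0.
    apply/subsetP=> y; rewrite in_set in_setC in_setD => /andP[y0 yx].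
    by rewrite (subsetP xX) // andbT; apply: contra y0; apply/subsetP/core_sub.
  apply: leq_trans (subset_leq_card h) _.
  move: cB0; rewrite !cardsD (setIidPr s0X) (setIidPr (core_sub X0)).
  have := subset_leq_card (core_sub X0); lia.
have S0 : core X :\: X0 = set0.
  by apply/setP=> x; rewrite [RHS]inE; apply/negP=> xS; have := cross x y xS yL.
rewrite S0 sub0set /=; apply/subsetP=> u; rewrite in_setD => /andP[uX u0].
rewrite in_set u0 /=.
have h : [set y in core X0 | u \in nbh y] \subset X0 :\: core X.
  apply/subsetP=> z; rewrite in_set in_setD => /andP[z0 uz].
  rewrite (subsetP (core_sub X0)) // andbT; apply: contra uX.
  by rewrite inE => /subsetP; apply.
have sX0 : core X \subset X0 by rewrite -setD_eq0 S0.
apply: leq_trans (subset_leq_card h) _.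
move: cB; rewrite !cardsD (setIidPr sX0) (setIidPr (core_sub X)).
have := subset_leq_card (core_sub X); lia.
Qed.

Lemma card_good_level k D m : path_decomposition e D ->
  (forall W, W \in D -> #|W| <= k.+1) ->
  #|[set X | good k X && (#|X| == m)]| <= 2 ^ (10 * k).
Proof.
move=> pD wD; have [mV|mV] := leqP m #|V|; last first.
  rewrite eq_card0 ?expn_gt0 // => X; rewrite !inE; apply/negP=> /andP[_ /eqP Xm].
  by have := max_card (mem X); rewrite Xm leqNgt mV.
have [X0 [g0 mX0 X0m]] := level_ref pD wD mV.
apply: leq_trans (card_good g0); apply: subset_leq_card; apply/subsetP=> X.
by rewrite !inE => /andP[-> /eqP->]; rewrite mX0 X0m.
Qed.

(** Candidates inside [X] lie on the boundary, at most [k] in number. One outside has at most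
    [k + 1] members of its closed neighbourhood in the complement of [X], and [low_degree] allows
    [2 (k + 1)] of these. *)
Lemma card_admissible k X : #|X :\: core X| <= k ->
  #|[set v | admissible k X v]| <= 3 * k + 2.
Proof.
move=> cB; rewrite -(cardsID X [set v | _]).
have h1 : [set v | admissible k X v] :&: X \subset X :\: core X.
  apply/subsetP=> v; rewrite in_setI inE in_setD -dfc_eq0 -lt0n /admissible.
  by case/andP => /andP[-> _] ->.
have h2 : [set v | admissible k X v] :\: X \subset
    [set x in ~: X | #|[set y in ~: X | y \in nbh x]| <= k.+1].
  apply/subsetP=> v; rewrite in_setD inE in_set in_setC => /andP[-> /andP[_ h]] /=.
  suff -> : [set y in ~: X | y \in nbh v] = nbh v :\: X by rewrite /dfc in h; lia.
  by apply/setP=> w; rewrite in_set in_setC in_setD.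
have := low_degree (r := fun x y => y \in nbh x) (~: X) k.+1.
move=> /(_ (fun x y => semi_complete_nbh x y)).
have := subset_leq_card h1; have := subset_leq_card h2; lia.
Qed.

End Graph.

(** * A Hoare logic for the word RAM *)

(** The values computed by [main] are natural, so states over [nat] suffice to reason about it;
    [simulates] leaves negative addresses unconstrained. *)
Record nstate := NState { nregs : seq nat; nmem : nat -> nat }.

Definition nupd (m : nat -> nat) (a x : nat) : nat -> nat :=
  fun b => if b == a then x else m b.

Definition neval_op (o : binop) (x y : nat) : nat :=
  match o with Add => x + y | Defs.Sub => x - y | Mul => x * y | Div => x %/ y end.

Fixpoint neval (s : nstate) (a : expr) : nat :=
  match a with
  | Const z => `|z|%N
  | Reg r => nth 0 (nregs s) r
  | Read b => nmem s (neval s b)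
  | Op o b1 b2 => neval_op o (neval s b1) (neval s b2)
  end.

(* The demand that no difference is negative makes the truncated subtraction in
   [neval_op] agree with the one on integers. *)
Fixpoint nfits (B : nat) (s : nstate) (a : expr) : Prop :=
  match a with
  | Const z => (0 <= z)%R /\ `|z|%N < B
  | Reg r => nth 0 (nregs s) r < B
  | Read b => nfits B s b /\ nmem s (neval s b) < B
  | Op o b1 b2 =>
      [/\ nfits B s b1, nfits B s b2,
          (if o is Defs.Sub then neval s b2 <= neval s b1 else True)
        & neval_op o (neval s b1) (neval s b2) < B]
  end.

Definition simulates (s : state) (ns : nstate) : Prop :=
  (forall i, regs s i = (nth 0 (nregs ns) i)%:Z%R) /\
  (forall a : nat, memory s a%:Z%R = (nmem ns a)%:Z%R).

Section Logic.
Variables (w B : nat).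
Hypothesis BE : B = 2 ^ w.

Lemma neval_eval s ns a : simulates s ns -> nfits B ns a ->
  eval s a = (neval ns a)%:Z%R /\ fits w s a.
Proof.
move=> [sr sm]; elim: a => [z|r|b IH|o b1 IH1 b2 IH2] /=.
- case: z => [z|z] [z0 zB] //=; rewrite andbT /word /= -BE.
  by split.
- by rewrite andbT /word sr /= -BE.
- by case=> /IH[-> ->] mB; rewrite sm andbT /word /= -BE mB.
- case=> /IH1[-> ->] /IH2[-> ->] sub oB; rewrite !andbT.
  have E : eval_op o (neval ns b1)%:Z%R (neval ns b2)%:Z%R =
      (neval_op o (neval ns b1) (neval ns b2))%:Z%R.
    by case: o sub {oB} => /= h; rewrite ?PoszD ?PoszM ?divz_nat ?subzn.
  by rewrite E /word /= -BE oB.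
Qed.

(** Termination, postcondition and time in one. [T] is only an upper bound, so the two branches of a
    conditional can share it. *)
Definition runs (p : cmd) (ns : nstate) (T : nat) (Q : nstate -> Prop) : Prop :=
  forall s, simulates s ns ->
  exists t s' ns', [/\ exec w p s t s', simulates s' ns', t <= T & Q ns'].

Lemma runs_weaken p ns T T' (Q Q' : nstate -> Prop) :
  runs p ns T Q -> T <= T' -> (forall ns', Q ns' -> Q' ns') -> runs p ns T' Q'.
Proof.
move=> H TT QQ s /H[t [s' [ns' [ex si tT q]]]].
by exists t, s', ns'; split; [| |apply: leq_trans TT|apply: QQ].
Qed.

Lemma runs_skip ns (Q : nstate -> Prop) : Q ns -> runs Skip ns 1 Q.
Proof. by move=> q s si; exists 1, s, ns; split=> //; constructor. Qed.

Lemma runs_assign r a ns (Q : nstate -> Prop) : nfits B ns a ->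
  Q (NState (set_nth 0 (nregs ns) r (neval ns a)) (nmem ns)) ->
  runs (Assign r a) ns (cost a).+1 Q.
Proof.
move=> na q s si; have [ev fi] := neval_eval si na.
exists (cost a).+1, (State (upd (regs s) r (eval s a)) (memory s)).
eexists; split; [by constructor| |by []|exact: q].
case: si => sr sm; split=> //= i.
by rewrite nth_set_nth /= /upd ev; case: eqP => // _; rewrite sr.
Qed.

Lemma runs_write a b ns (Q : nstate -> Prop) : nfits B ns a -> nfits B ns b ->
  Q (NState (nregs ns) (nupd (nmem ns) (neval ns a) (neval ns b))) ->
  runs (Write a b) ns (cost a + cost b).+1 Q.
Proof.
move=> na nb q s si; have [ea fa] := neval_eval si na.
have [eb fb] := neval_eval si nb.
exists (cost a + cost b).+1, (State (regs s) (upd (memory s) (eval s a) (eval s b))).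
eexists; split; [by constructor| |by []|exact: q].
case: si => sr sm; split=> //= i.
by rewrite /upd /nupd ea eb eqz_nat; case: eqP => // _; rewrite sm.
Qed.

Lemma runs_seq p q ns T1 T2 (Q : nstate -> Prop) :
  runs p ns T1 (fun ns' => runs q ns' T2 Q) -> runs (Seq p q) ns (T1 + T2) Q.
Proof.
move=> H s /H[t1 [s1 [ns1 [ex1 si1 tT1 /(_ _ si1)[t2 [s2 [ns2 [ex2 si2 tT2 q2]]]]]]]].
exists (t1 + t2), s2, ns2; split=> //; last exact: leq_add.
exact: exec_seq ex1 ex2.
Qed.

Lemma runs_if a b p q ns T (Q : nstate -> Prop) :
  nfits B ns a -> nfits B ns b ->
  (neval ns a <= neval ns b -> runs p ns T Q) ->
  (neval ns b < neval ns a -> runs q ns T Q) ->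
  runs (If a b p q) ns (cost a + cost b + T).+1 Q.
Proof.
move=> na nb Hp Hq s si; have [ea fa] := neval_eval si na.
have [eb fb] := neval_eval si nb.
have : runs (if (eval s a <= eval s b)%R then p else q) ns T Q.
  by rewrite ea eb lez_nat; case: leqP => [/Hp|/Hq].
move=> /(_ _ si)[t [s' [ns' [ex si' tT q']]]].
exists (cost a + cost b + t).+1, s', ns'; split=> //; last by rewrite ltnS leq_add2l.
exact: exec_if.
Qed.

(** [N] bounds the number of rounds without fixing it: the loop may stop earlier, and the time of
    the rounds not made simply remains in the bound. *)
Lemma runs_while a b p ns N i0 (T : nat -> nat) (I : nat -> nstate -> Prop)
    (Q : nstate -> Prop) :
  i0 <= N -> I i0 ns ->
  (forall i ns, I i ns -> [/\ nfits B ns a, nfits B ns b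
     & if neval ns a <= neval ns b
       then i < N /\ runs p ns (T i) (I i.+1) else Q ns]) ->
  runs (While a b p) ns (\sum_(i0 <= i < N) (T i + (cost a + cost b).+1) + (cost a + cost b).+1) Q.
Proof.
move=> le_iN Ii H.
have [d iN] : exists d, i0 + d = N by exists (N - i0); apply: subnKC.
elim: d i0 ns iN Ii {le_iN} => [|d IH] i ns iN Ii s si.
  have [na nb] := H _ _ Ii; have [ea fa] := neval_eval si na.
  have [eb fb] := neval_eval si nb.
  case: ifP => ab; first by case; lia.
  exists (cost a + cost b).+1, s, ns; split=> //; last by rewrite leq_addl.
  by apply: exec_while_end; rewrite // ea eb lez_nat ab.
have [na nb] := H _ _ Ii; have [ea fa] := neval_eval si na.
have [eb fb] := neval_eval si nb.
case: ifP => ab; last first.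
  move=> q; exists (cost a + cost b).+1, s, ns; split=> //; last by rewrite leq_addl.
  by apply: exec_while_end; rewrite // ea eb lez_nat ab.
case=> lt_iN /(_ _ si)[t1 [s1 [ns1 [ex1 si1 tT1 I1]]]].
have [|t2 [s2 [ns2 [ex2 si2 tT2 q2]]]] := IH i.+1 ns1 _ I1 s1 si1; first by lia.
exists (cost a + cost b + t1 + t2).+1, s2, ns2; split=> //.
  by apply: exec_while_loop ex1 ex2; rewrite // ea eb lez_nat.
rewrite (@big_ltn _ _ _ i) //; lia.
Qed.

Definition succ_reg i := Assign i (Op Add (Reg i) (Const (Posz 1))).
(** The test is [i + 1 <= b] because only [<=] is available. The counter is not initialised here. *)
Definition for_loop (i b : nat) (p : cmd) : cmd :=
  While (Op Add (Reg i) (Const (Posz 1))) (Reg b) (Seq p (succ_reg i)).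

(** A round is charged 5 units for the test and 4 for the increment; the last 5 pay for the failing
    test, which evaluates [N + 1], whence [N.+1 < B]. *)
Lemma runs_for i b p ns N j0 (T : nat -> nat) (I : nat -> nstate -> Prop)
    (Q : nstate -> Prop) :
  j0 <= N -> N.+1 < B -> I j0 ns ->
  (forall j ns, I j ns -> nth 0 (nregs ns) i = j /\ nth 0 (nregs ns) b = N) ->
  (forall j ns, j0 <= j -> j < N -> I j ns -> runs p ns (T j)
     (fun ns' => nth 0 (nregs ns') i = j /\
        I j.+1 (NState (set_nth 0 (nregs ns') i j.+1) (nmem ns')))) ->
  (forall ns, I N ns -> Q ns) ->
  runs (for_loop i b p) ns (\sum_(j0 <= j < N) (T j + 9) + 5) Q.
Proof.
move=> jN NB I0 Ir Ip IQ.
pose J j ns := [/\ I j ns, j0 <= j & j <= N].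
rewrite /for_loop; eapply runs_weaken; last by move=> ?; apply.
  apply: (runs_while (I := J) (T := fun j => T j + 4) jN) => [|j ns1 [Ij jj jN']]; first by split.
  have [ri rb] := Ir _ _ Ij.
  rewrite /= ri rb addn1; split.
  - by split=> //; lia.
  - lia.
  case: ltnP => [{}jN'|{}Nj]; last by apply: IQ; have <- : j = N by lia.
  split=> //; apply: runs_seq; apply: runs_weaken (Ip _ _ jj jN' Ij) _ _ => //.
  move=> ns' [ri' I'].
  apply: (runs_assign (a := Op Add (Reg i) (Const (Posz 1)))); rewrite /= ri' addn1 //.
    by split=> //; lia.
  by split=> //; lia.
by apply: (leq_add _ (leqnn 5)); apply: leq_sum => j _ /=; lia.
Qed.

Lemma runs_for_ord i b p ns N (T : nat -> nat) (I : nat -> nstate -> Prop)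
    (Q : nstate -> Prop) :
  N.+1 < B -> I 0 ns ->
  (forall j ns, I j ns -> nth 0 (nregs ns) i = j /\ nth 0 (nregs ns) b = N) ->
  (forall (j : 'I_N) ns, I j ns -> runs p ns (T j)
     (fun ns' => nth 0 (nregs ns') i = j /\
        I j.+1 (NState (set_nth 0 (nregs ns') i j.+1) (nmem ns')))) ->
  (forall ns, I N ns -> Q ns) ->
  runs (for_loop i b p) ns (\sum_(0 <= j < N) (T j + 9) + 5) Q.
Proof.
move=> NB I0 Ir Ip; apply: runs_for NB I0 Ir _ => // j ns1 _ jN.
exact: (Ip (Ordinal jN)).
Qed.
End Logic.

(** * The program *)

Notation "a |+| b" := (Op Add a b) (at level 50, left associativity).
Notation "a |-| b" := (Op Defs.Sub a b) (at level 50, left associativity).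
Notation "a |*| b" := (Op Mul a b) (at level 40, left associativity).
Notation "p ;; q" := (Seq p q) (at level 100, right associativity).

Notation cst c := (Const (Posz c)).
(** [rK] holds [k] and, after the setup, [k + 1]; [rG] holds [2 ^ (10 k)]. [rhead] and [rtail]
    delimit the queue of records, [rgoal] is the number of a record of the full set or 0. During the
    search [rp] and [rb] are the address and boundary size of the record being expanded, [rnew] is
    the address of the record being built, and [rq], [rpq] are number and address of one compared
    with it. *)
Notation rN := (Reg 0).
Notation rK := (Reg 1).
Notation rG := (Reg 2).
Notation rhead := (Reg 3).
Notation rtail := (Reg 4).
Notation rgoal := (Reg 5).
Notation rp := (Reg 6).
Notation rb := (Reg 7).
Notation rv := (Reg 8).
Notation rnew := (Reg 9).
Notation ru := (Reg 10).
Notation rx := (Reg 11).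
Notation rc := (Reg 12).
Notation rq := (Reg 13).
Notation rpq := (Reg 14).
Notation rbase := (Reg 15).
Notation rsize := (Reg 16).

(* A set X is stored as a record of length 2 n + 2 at an address p: the size of X,
   the number of the record it was obtained from, the characteristic function of X
   (read by [mark]) and the numbers |N u :\: X| (read by [defi]). *)
Definition mark (p u : expr) := Read (p |+| u |+| cst 2).
Definition defi (p u : expr) := Read (p |+| rN |+| u |+| cst 2).
Definition adj (v u : expr) := Read (v |*| rN |+| u).

Definition shrink_loop :=
  for_loop 11 0 (Write (rnew |+| rN |+| rx |+| cst 2) (defi rnew rx |-| adj rx ru)).
(** On 0/1 values the test says that [ru] is missing from the set and belongs to the neighbourhood
    of [rv]. *)
Definition insert_loop :=
  for_loop 10 0 (If (mark rnew ru |+| cst 1) (adj rv ru)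
    (Write (rnew |+| ru |+| cst 2) (cst 1) ;; Assign 11 (cst 0) ;; shrink_loop)
    Skip).
Definition copy_loop := for_loop 10 16 (Write (rnew |+| ru) (Read (rp |+| ru))).
Definition new_record :=
  Assign 9 (rbase |+| rtail |*| rsize) ;;
  Assign 10 (cst 0) ;; copy_loop ;;
  Write rnew (Read rp |+| defi rp rv) ;;
  Write (rnew |+| cst 1) rhead ;;
  Assign 10 (cst 0) ;; insert_loop.
Definition subset_loop :=
  for_loop 10 0 (If (mark rpq ru) (mark rnew ru) Skip (Assign 11 (cst 1))).
(* The two sets have the same size, so that inclusion means equality.  A duplicate
   is signalled by adding [G] to the number [rc] of sets of this size. *)
Definition compare :=
  Assign 12 (rc |+| cst 1) ;; Assign 11 (cst 0) ;; Assign 10 (cst 0) ;;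
  subset_loop ;; If rx (cst 0) (Assign 12 (rc |+| rG)) Skip.
(** The nested tests establish equality of the sizes first, so that few records undergo the
    comparison in time [O(n)]. *)
Definition scan_loop :=
  for_loop 13 4 (
    Assign 14 (rbase |+| rq |*| rsize) ;;
    If (Read rpq) (Read rnew) (If (Read rnew) (Read rpq) compare Skip) Skip).
(** The new record is written behind the table in any case and accepted by advancing [rtail]. As a
    duplicate adds [G] to [rc], the single test rejects duplicates and full levels alike. *)
Definition expand :=
  new_record ;; Assign 12 (cst 0) ;; Assign 13 (cst 0) ;; scan_loop ;;
  If (rc |+| cst 1) rG (Assign 4 (rtail |+| cst 1)) Skip.
Definition boundary_loop :=
  for_loop 10 0 (If (cst 1) (mark rp ru |*| defi rp ru) (Assign 7 (rb |+| cst 1)) Skip).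
Definition expand_loop :=
  for_loop 8 0 (If (cst 1) (defi rp rv) (If (rb |+| defi rp rv) rK expand Skip) Skip).
Definition visit :=
  Assign 6 (rbase |+| rhead |*| rsize) ;;
  If rN (Read rp) (Assign 5 rhead) Skip ;;
  Assign 7 (cst 0) ;; Assign 10 (cst 0) ;; boundary_loop ;;
  Assign 8 (cst 0) ;; expand_loop.
Definition search_loop := While (rhead |+| cst 1) rtail (visit ;; succ_reg 3).

Definition pow_loop := for_loop 10 1 (Assign 2 (rG |*| cst 1024)).
Definition degree_loop := for_loop 10 0 (Assign 11 (rx |+| adj rv ru)).
(** Setting the diagonal turns the adjacency matrix into that of the closed out-neighbourhoods. The
    row sums complete record 0, that of the empty set. *)
Definition row_loop :=
  for_loop 8 0 (
    Write (rv |*| rN |+| rv) (cst 1) ;;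
    Assign 11 (cst 0) ;; Assign 10 (cst 0) ;; degree_loop ;;
    Write (rbase |+| rN |+| rv |+| cst 2) rx).
Definition setup :=
  Assign 15 (rN |*| rN) ;; Assign 16 (cst 2 |*| rN |+| cst 2) ;;
  Assign 2 (cst 1) ;; pow_loop ;; Assign 1 (rK |+| cst 1) ;;
  row_loop ;; Assign 4 (cst 1).

(** The mark is read from the child and the deficiency from the parent, so the product is positive
    exactly on [X' :\: core X]. *)
Definition bag_loop :=
  for_loop 10 0 (If (cst 1) (mark rpq ru |*| defi rp ru)
    (Assign 9 (rnew |-| cst 1) ;; Write rnew ru ;; Assign 11 (rx |+| cst 1)) Skip).
(* The parent pointers yield the bags from right to left, hence they are written
   at decreasing addresses. *)
Definition output_loop :=
  While (cst 1) rq (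
    Assign 14 (rbase |+| rq |*| rsize) ;;
    Assign 6 (rbase |+| Read (rpq |+| cst 1) |*| rsize) ;;
    Assign 11 (cst 0) ;; Assign 10 (cst 0) ;; bag_loop ;;
    Assign 9 (rnew |-| cst 1) ;; Write rnew rx ;;
    Assign 12 (rc |+| cst 1) ;; Assign 13 (Read (rpq |+| cst 1))).
(** The area of [n (n + 1) + 2] cells suffices for at most [n] bags, each with at most [n] vertices
    and its length, and for the number of bags. *)
Definition output :=
  Assign 9 (rbase |+| rtail |*| rsize |+| rN |*| (rN |+| cst 1) |+| cst 2) ;;
  Assign 12 (cst 0) ;; Assign 13 rgoal ;; output_loop ;;
  Assign 9 (rnew |-| cst 1) ;; Write rnew rc ;; Assign 1 rnew ;; Assign 0 (cst 1).

Definition main :=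
  setup ;; search_loop ;; If rgoal (cst 0) (Assign 0 (cst 0)) output.

Ltac fits := rewrite /=; repeat split; try done; try lia.

Ltac updates := rewrite /nupd; do ?(case: eqP => [?|_]; first by [lia]).

(** Membership extended to all of [nat], because time bounds are sums over natural loop indices. *)
Definition memn n (A : {set 'I_n}) (j : nat) : bool := oapp (mem A) false (insub j).

Lemma memn_ord n (A : {set 'I_n}) (i : 'I_n) : memn A i = (i \in A).
Proof. by rewrite /memn valK. Qed.

Lemma sum_memn n (A : {set 'I_n}) c d :
  \sum_(0 <= j < n) (c + memn A j * d) = n * c + #|A| * d.
Proof.
rewrite big_split /= sum_nat_const_nat subn0; congr (_ + _).
rewrite -big_distrl /= big_mkord -sum1_card [in RHS]big_mkcond; congr (_ * _).
by apply: eq_bigr => i _; rewrite memn_ord; case: ifP.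
Qed.

Lemma matrix_index n (v u : 'I_n) : v * n + u < n * n.
Proof. by have := ltn_ord v; have := ltn_ord u; nia. Qed.

Lemma matrix_index_inj n (v u v' u' : 'I_n) : v * n + u = v' * n + u' -> v = v' /\ u = u'.
Proof.
move=> E; have n0 : 0 < n by apply: leq_trans (ltn_ord v).
have Ev : v = v' :> nat.
  by have := congr1 (divn^~ n) E; rewrite !divnMDl // !divn_small // !addn0.
by split; apply: val_inj => //=; move: E; rewrite Ev; apply: addnI.
Qed.

(** * Correctness of the program: building a record *)

Section Spec.
Variables (n k : nat) (e : rel 'I_n) (w B G : nat).
Hypotheses (BE : B = 2 ^ w) (n_gt0 : 0 < n) (G_gt0 : 0 < G).
(** [B_mem] makes addresses words: the matrix, [(n + 1) G] records and one under construction, and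
    the output. [B_cnt] does so for the counter [rc], to which a duplicate adds [G], and for the
    computation of [G]. *)
Hypothesis B_mem : n * n + (n.+1 * G).+1 * (2 * n + 2) + n * n.+1 + 10 < B.
Hypothesis B_cnt : (n.+1 * G).+1 * G.+1 + 1024 * G < B.
Hypothesis k_G : k < G.

Definition file (h t a p b v np u x c q pq : nat) : seq nat :=
  [:: n; k.+1; G; h; t; a; p; b; v; np; u; x; c; q; pq; n * n; 2 * n + 2].

Definition address q := n * n + q * (2 * n + 2).

Definition matrix_at (m : nat -> nat) :=
  forall v u : 'I_n, m (v * n + u) = (u \in nbh e v) :> nat.

Definition order (X : {set 'I_n}) : nat := #|X|.

Definition record_at (m : nat -> nat) (a : nat) (X : {set 'I_n}) (par : nat) :=
  [/\ m a = order X, m a.+1 = par, (forall u : 'I_n, m (a + u + 2) = (u \in X))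
    & forall u : 'I_n, m (a + n + u + 2) = dfc e X u].

Lemma dfc_le (X : {set 'I_n}) u : dfc e X u <= n.
Proof. by rewrite /dfc -[leqRHS]card_ord; apply: max_card. Qed.

Lemma cardn X : order X <= n.
Proof. by rewrite /order -[leqRHS]card_ord; apply: max_card. Qed.

Lemma card_stepn X v : order (X :|: nbh e v) = order X + dfc e X v.
Proof. exact: card_step. Qed.

Lemma address_bound q : q <= n.+1 * G -> address q + (2 * n + 2) + n * n.+1 + 10 < B.
Proof.
move=> qG; apply: leq_ltn_trans B_mem; rewrite /address.
have : q.+1 * (2 * n + 2) <= (n.+1 * G).+1 * (2 * n + 2) by rewrite leq_mul2r ltnS qG orbT.
rewrite mulSn; lia.
Qed.

Lemma tail_bound t : t <= n.+1 * G -> t + 10 < B.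
Proof.
move=> tG; have h : t <= t * (2 * n + 2) by rewrite leq_pmulr // addnS.
by have := address_bound tG; rewrite /address; lia.
Qed.

Lemma address_lt q t : q < t -> address q + 2 * n + 2 <= address t.
Proof.
move=> qt; rewrite /address.
have : q.+1 * (2 * n + 2) <= t * (2 * n + 2) by rewrite leq_mul2r qt orbT.
rewrite mulSn; lia.
Qed.

Lemma matrix_frame m m' : (forall a, a < n * n -> m' a = m a) ->
  matrix_at m -> matrix_at m'.
Proof. by move=> E A v u; rewrite E // matrix_index. Qed.

Lemma dfc_add (X : {set 'I_n}) u v : u \notin X -> dfc e (u |: X) v = dfc e X v - (u \in nbh e v).
Proof.
move=> uX; rewrite /dfc [in RHS](cardsD1 u) in_setD uX /= addKn.
by apply: eq_card => x; rewrite !inE negb_or andbA.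
Qed.

Lemma runs_shrink h t a p b v np c q pq m (X : {set 'I_n}) (u : 'I_n) :
  matrix_at m -> n * n <= np -> np + 2 * n + 2 + 10 < B -> u \notin X ->
  (forall v : 'I_n, m (np + n + v + 2) = dfc e X v) ->
  runs w shrink_loop (NState (file h t a p b v np (nat_of_ord u) 0 c q pq) m) (32 * n + 5)
    (fun ns => exists m',
      [/\ ns = NState (file h t a p b v np u n c q pq) m',
          forall v : 'I_n, m' (np + n + v + 2) = dfc e (u |: X) v
        & forall a, ~~ (np + n + 2 <= a < np + 2 * n + 2) -> m' a = m a]).
Proof.
move=> mA np1 np2 uX mD.
pose I j ns := exists m',
      [/\ ns = NState (file h t a p b v np u j c q pq) m',
          forall v : 'I_n, m' (np + n + v + 2) = if v < j then dfc e (u |: X) v else dfc e X v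
        & forall a, ~~ (np + n + 2 <= a < np + 2 * n + 2) -> m' a = m a].
apply: (runs_weaken (T := \sum_(0 <= j < n) (23 + 9) + 5) (Q := I n)) => //.
- apply: (runs_for BE (I := I)) => //.
  + lia.
  + by exists m; split=> // x; rewrite mD.
  + by move=> j ns [m' [-> _ _]].
  move=> j ns _ jn [m' [-> mD' fr]].
  have Ej := mD' (Ordinal jn); rewrite /= ltnn in Ej.
  have Aj : m' (j * n + u) = (u \in nbh e (Ordinal jn)).
    by rewrite -mA fr //=; have := matrix_index (Ordinal jn) u => /=; lia.
  have jn' := matrix_index (Ordinal jn) u; rewrite /= in jn'.
  have dj := dfc_le X (Ordinal jn).
  (* The subtraction never becomes negative: a neighbour [u] outside [X] is itself counted by
     [dfc]. *)
  have dS : (u \in nbh e (Ordinal jn) : nat) <= dfc e X (Ordinal jn).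
    case: (boolP (u \in _)) => // uj; rewrite /dfc card_gt0.
    by apply/set0Pn; exists u; rewrite inE uX.
  apply: (runs_write BE) => /=.
  + by fits.
  + by rewrite /= Ej Aj; fits.
  split=> //; exists (nupd m' (np + n + j + 2) (dfc e (u |: X) (Ordinal jn))); split=> //.
  + by rewrite Ej Aj dfc_add.
  + move=> x; rewrite /nupd mD' ltnS.
    case: eqP => E; first by have -> : x = Ordinal jn by [apply/val_inj => /=; lia]; rewrite /= leqnn.
    by rewrite [in RHS]leq_eqVlt; case: eqP => // E'; case: E; rewrite E'.
  move=> x hx; rewrite /nupd fr //; case: eqP => // E; move: hx; rewrite E; lia.
- by rewrite sum_nat_const_nat; lia.
move=> ns [m' [-> mD' fr]]; exists m'; split=> // x; by rewrite mD' ltn_ord.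
Qed.

Definition upto (A : {set 'I_n}) j : {set 'I_n} := [set u in A | u < j].

Lemma upto0 A : upto A 0 = set0.
Proof. by apply/setP=> u; rewrite !inE ltn0 andbF. Qed.

Lemma upton A : upto A n = A.
Proof. by apply/setP=> u; rewrite !inE ltn_ord andbT. Qed.

Lemma uptoS A (j : 'I_n) : upto A j.+1 = if j \in A then j |: upto A j else upto A j.
Proof.
apply/setP=> u; case: ifP => jA; rewrite !inE ltnS leq_eqVlt (inj_eq val_inj).
  by case: eqP => [->|]; rewrite ?jA.
by case: eqP => [->|]; rewrite ?jA.
Qed.

(** The expensive branch is entered once for each of the [dfc e X v] new vertices, at most [k + 1]
    in an admissible step, so the time stays linear in [n]. *)
Lemma runs_insert h t a p b np x c q pq m (X : {set 'I_n}) (v : 'I_n) :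
  matrix_at m -> n * n <= np -> np + 2 * n + 2 + 10 < B ->
  (forall u : 'I_n, m (np + u + 2) = (u \in X)) ->
  (forall u : 'I_n, m (np + n + u + 2) = dfc e X u) ->
  runs w insert_loop (NState (file h t a p b v np 0 x c q pq) m)
    (n * 25 + dfc e X v * (32 * n + 14) + 5)
    (fun ns => exists x' m',
      [/\ ns = NState (file h t a p b v np n x' c q pq) m',
          forall u : 'I_n, m' (np + u + 2) = (u \in X :|: nbh e v),
          forall u : 'I_n, m' (np + n + u + 2) = dfc e (X :|: nbh e v) u
        & forall a, ~~ (np + 2 <= a < np + 2 * n + 2) -> m' a = m a]).
Proof.
move=> mA np1 np2 mM mD.
pose Xj j := X :|: upto (nbh e v) j.
pose I j ns := exists x' m',
      [/\ ns = NState (file h t a p b v np j x' c q pq) m',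
          forall u : 'I_n, m' (np + u + 2) = (u \in Xj j),
          forall u : 'I_n, m' (np + n + u + 2) = dfc e (Xj j) u
        & forall a, ~~ (np + 2 <= a < np + 2 * n + 2) -> m' a = m a].
apply: (runs_weaken (T := \sum_(0 <= j < n) (16 + memn (nbh e v :\: X) j * (32 * n + 14) + 9) + 5) (Q := I n)) => //.
- apply: (runs_for_ord BE (I := I)) => //.
  + lia.
  + by exists x, m; split=> // u; rewrite /Xj upto0 setU0.
  + by move=> j ns [x' [m' [-> _ _ _]]].
  move=> i ns [x' [m' [-> mM' mD' fr]]].
  have Mi := mM' i; have Ai := mA v i; have vi := matrix_index v i.
  rewrite -fr in Ai; last by lia.
  have iE : (i \in Xj i) = (i \in X) by rewrite !inE ltnn andbF orbF.
  rewrite iE in Mi; have i_n := ltn_ord i; have v_n := ltn_ord v.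
  have XjS : Xj i.+1 = if i \in nbh e v then i |: Xj i else Xj i.
    by rewrite /Xj uptoS; case: ifP => // _; rewrite setUCA.
  apply: (runs_weaken (T := _) (Q := _)); last by move=> ?; apply.
    apply: (runs_if BE (T := 1 + memn (nbh e v :\: X) i * (32 * n + 13))) => /=.
    + by rewrite Mi; fits.
    + by rewrite Ai; fits.
    + rewrite Mi Ai memn_ord in_setD => le.
      have [iX iv] : i \notin X /\ i \in nbh e v by move: le; case: (i \in X); case: (i \in nbh e v).
      rewrite iX iv mul1n.
      apply: (runs_weaken (T := 7 + (2 + (32 * n + 5))) (Q := _)); [|lia|by move=> ?; apply].
      apply: runs_seq; apply: (runs_write BE) => /=; [by fits|by fits|].
      apply: runs_seq; apply: (runs_assign BE) => /=; first by fits.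
      apply: (runs_weaken (Q := _)).
        apply: (@runs_shrink h t a p b v np c q pq _ (Xj i) i) => //.
        * by apply: matrix_frame mA => z zn; rewrite /nupd; case: eqP => [|_]; [lia|apply: fr; lia].
        * by rewrite iE.
        * by move=> u; rewrite /nupd mD'; case: eqP => //; have := ltn_ord u; lia.
        * by [].
      move=> ns1 [m1 [-> mD1 fr1]] /=; split=> //.
      exists n, m1; split=> //.
      * move=> u; rewrite fr1; last by have := ltn_ord u; lia.
        rewrite /nupd XjS iv in_setU1 mM'.
        have [->|ui] := eqVneq u i; first by rewrite eqxx.
        have {}ui : u != i :> nat by rewrite (inj_eq val_inj).
        by case: eqP => //; lia.
      * by move=> u; rewrite XjS iv.
      * by move=> z hz; rewrite fr1 /nupd; [case: eqP => [|_]; [lia|apply: fr; lia]|lia].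
    rewrite Mi Ai memn_ord in_setD => gt.
    apply: (runs_weaken (T := 1) (Q := _)); [|lia|by move=> ?; apply].
    apply: runs_skip; split=> //; exists x', m'.
    have -> : Xj i.+1 = Xj i.
      rewrite XjS; case: ifP => // iv; apply/setUidPr; rewrite sub1set iE.
      by move: gt; rewrite iv; case: (i \in X).
    by split.
  by rewrite /=; lia.
- rewrite (eq_bigr (fun j => 25 + memn (nbh e v :\: X) j * (32 * n + 14))); last by move=> j _; lia.
  by rewrite sum_memn.
move=> ns [x' [m' [-> mM' mD' fr]]]; exists x', m'; rewrite /Xj upton in mM' mD'; by split.
Qed.

Lemma runs_copy h t a p b v np x c q pq m :
  p + 2 * n + 2 <= np -> np + 2 * n + 2 + 10 < B ->
  (forall j, j < 2 * n + 2 -> m (p + j) < B) ->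
  runs w copy_loop (NState (file h t a p b v np 0 x c q pq) m) ((2 * n + 2) * 17 + 5)
    (fun ns => exists m',
      [/\ ns = NState (file h t a p b v np (2 * n + 2) x c q pq) m',
          forall j, j < 2 * n + 2 -> m' (np + j) = m (p + j)
        & forall z, z < np -> m' z = m z]).
Proof.
move=> pnp npB mB.
pose I j ns := exists m',
      [/\ ns = NState (file h t a p b v np j x c q pq) m',
          forall i, i < j -> m' (np + i) = m (p + i)
        & forall z, z < np -> m' z = m z].
apply: (runs_weaken (T := \sum_(0 <= j < 2 * n + 2) (8 + 9) + 5) (Q := I (2 * n + 2))) => //.
- apply: (runs_for_ord BE (I := I)) => //.
  + lia.
  + by exists m.
  + by move=> j ns [m' [-> _ _]].
  move=> i ns [m' [-> mC fr]]; have := ltn_ord i; have := mB i (ltn_ord i) => mBi i_n.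
  rewrite -fr in mBi; last by lia.
  apply: (runs_write BE) => /=; [by fits|by fits|].
  split=> //; eexists; split=> // [j ji|z zn]; rewrite /nupd; case: eqP => [E|E].
  + by have -> : j = i by [lia]; rewrite fr //; lia.
  + by apply: mC; lia.
  + by lia.
  + exact: fr.
- by rewrite sum_nat_const_nat; lia.
Qed.

Lemma record_lt m a X par j : record_at m a X par -> par < B -> n < B -> 1 < B ->
  j < 2 * n + 2 -> m (a + j) < B.
Proof.
move=> [m0 m1 mM mD] pB nB B1; case: j => [|[|j]] jn.
- by rewrite addn0 m0; apply: leq_ltn_trans nB; apply: cardn.
- by rewrite addn1 m1.
have [jn'|jn'] := ltnP j n.
  have -> : a + j.+2 = a + Ordinal jn' + 2 by rewrite /=; lia.
  by rewrite mM; case: (_ \in X); lia.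
have jn2 : j - n < n by lia.
have -> : a + j.+2 = a + n + Ordinal jn2 + 2 by rewrite /=; lia.
by rewrite mD; apply: leq_ltn_trans nB; apply: dfc_le.
Qed.

Lemma runs_new_record h t a b np u x c q pq m X par (v : 'I_n) :
  matrix_at m -> record_at m (address h) X par -> par < B -> h < t -> t <= n.+1 * G ->
  runs w new_record (NState (file h t a (address h) b v np u x c q pq) m)
    (59 * n + dfc e X v * (32 * n + 14) + 72)
    (fun ns => exists u' x' m',
      [/\ ns = NState (file h t a (address h) b v (address t) u' x' c q pq) m',
          record_at m' (address t) (X :|: nbh e v) h
        & forall z, z < address t -> m' z = m z]).
Proof.
move=> mA mX parB ht tG; have tB := address_bound tG.
have hA := address_lt ht.
have nnA : n * n <= address h by rewrite /address leq_addr.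
have tsz : t * (2 * n + 2) <= address t by rewrite /address leq_addl.
have tB' : t < B by lia.
have tB2 : n * n + t * (2 * n + 2) < B by rewrite /address in tB; lia.
set T := _ + 72; have -> : T = 6 + (2 + ((2 * n + 2) * 17 + 5 + (13 + (5 + (2 +
   (n * 25 + dfc e X v * (32 * n + 14) + 5)))))) by rewrite /T; lia.
apply: runs_seq; apply: (runs_assign BE) => /=; first by fits.
rewrite -/(address t); apply: runs_seq; apply: (runs_assign BE) => /=; first by fits.
apply: runs_seq; apply: runs_weaken.
- apply: (@runs_copy h t a (address h) b v (address t) x c q pq m); [lia|lia|].
  by move=> j jn; apply: record_lt mX _ _ _ _ => //; lia.
- by [].
move=> ns [m1 [-> m1C fr1]].
case: (mX) => mX0 mX1 mM mD; have v_n := ltn_ord v.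
have E0 : m1 (address h) = order X by rewrite fr1 //; lia.
have Ev : m1 (address h + n + v + 2) = dfc e X v by rewrite fr1 //; lia.
have cX := card_stepn X v; have := cardn (X :|: nbh e v); rewrite cX => cn.
apply: runs_seq; apply: (runs_write BE) => /=.
- by fits.
- by rewrite E0 Ev; fits.
rewrite E0 Ev; apply: runs_seq; apply: (runs_write BE) => /=; [by fits|by fits|].
apply: runs_seq; apply: (runs_assign BE) => /=; first by fits.
apply: (runs_weaken (Q := _)).
- apply: (@runs_insert h t a (address h) b (address t) x c q pq _ X v) => //.
  + by apply: matrix_frame mA => z zn; updates; apply: fr1; lia.
  + lia.
  + lia.
  + move=> y; have yn := ltn_ord y; updates.
    have -> : address t + y + 2 = address t + (y + 2) by lia.
    by rewrite m1C ?addnA ?mM //; lia.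
  + move=> y; have yn := ltn_ord y; updates.
    have -> : address t + n + y + 2 = address t + (n + y + 2) by lia.
    by rewrite m1C ?addnA ?mD //; lia.
- by [].
move=> ns1 [x' [m' [-> mM' mD' fr]]]; exists n, x', m'; split=> //.
  split=> //.
  + by rewrite fr; [updates; rewrite eqxx card_stepn|lia].
  + by rewrite fr /nupd ?addn1 ?eqxx //; lia.
move=> z zt; rewrite fr; last by lia.
by updates; apply: fr1.
Qed.

Lemma record_mark m a X par (u : 'I_n) : record_at m a X par -> m (a + u + 2) = (u \in X).
Proof. by case. Qed.

Lemma record_defi m a X par (u : 'I_n) : record_at m a X par -> m (a + n + u + 2) = dfc e X u.
Proof. by case. Qed.

Lemma runs_subset h t a p b v np c q pq m X Y parX parY :
  record_at m np X parX -> record_at m pq Y parY ->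
  np + 2 * n + 2 + 10 < B -> pq + 2 * n + 2 + 10 < B ->
  runs w subset_loop (NState (file h t a p b v np 0 0 c q pq) m) (24 * n + 5)
    (fun ns => ns = NState (file h t a p b v np n (~~ (Y \subset X)) c q pq) m).
Proof.
move=> mX mY npB pqB.
pose I j ns := ns = NState (file h t a p b v np j (~~ (upto Y j \subset X)) c q pq) m.
apply: (runs_weaken (T := \sum_(0 <= j < n) (15 + 9) + 5) (Q := I n)) => //.
- apply: (runs_for_ord BE (I := I)) => //.
  + lia.
  + by rewrite /I upto0 sub0set.
  + by move=> j ns ->.
  move=> i ns ->; have := ltn_ord i => i_n.
  have Mx := record_mark i mX; have My := record_mark i mY.
  have S : upto Y i.+1 \subset X = (upto Y i \subset X) && ((i \in Y) ==> (i \in X)).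
    by rewrite uptoS; case: (i \in Y); rewrite ?andbT // subUset sub1set andbC.
  apply: (runs_if BE (T := 2)) => /=.
  + by rewrite My; fits.
  + by rewrite Mx; fits.
  + rewrite Mx My => le; apply: (runs_weaken (T := 1) (Q := _)); [|by []|by move=> ?; apply].
    apply: runs_skip; split=> //=; rewrite /I S.
    have -> : (i \in Y) ==> (i \in X) by move: le; case: (i \in Y); case: (i \in X).
    by rewrite andbT.
  + rewrite Mx My => gt; apply: (runs_assign BE); first by fits.
    split=> //=; rewrite /I S.
    have -> : (i \in Y) ==> (i \in X) = false by move: gt; case: (i \in Y); case: (i \in X).
    by rewrite andbF.
- by rewrite sum_nat_const_nat; lia.
- by move=> ns ->; rewrite upton.
Qed.

Lemma runs_compare h t a p b v np u x c q pq m X Y parX parY :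
  record_at m np X parX -> record_at m pq Y parY ->
  np + 2 * n + 2 + 10 < B -> pq + 2 * n + 2 + 10 < B -> c + 1 + G < B ->
  runs w compare (NState (file h t a p b v np u x c q pq) m) (24 * n + 20)
    (fun ns => exists x', ns = NState (file h t a p b v np n x' (c + 1 + (Y \subset X) * G) q pq) m).
Proof.
move=> mX mY npB pqB cB.
apply: (runs_weaken (T := 4 + (2 + (2 + (24 * n + 5 + 7)))) (Q := _)); [|lia|by move=> ?; apply].
apply: runs_seq; apply: (runs_assign BE) => /=; first by fits.
apply: runs_seq; apply: (runs_assign BE) => /=; first by fits.
apply: runs_seq; apply: (runs_assign BE) => /=; first by fits.
apply: runs_seq; apply: runs_weaken; [by apply: runs_subset mX mY _ _; lia|by []|].
move=> ns ->; apply: (runs_if BE (T := 4)) => /=; [by fits; case: (_ \subset _); lia|by fits| |].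
- case: (Y \subset X) => //= _; apply: (runs_assign BE); first by fits.
  by exists 0; rewrite mul1n.
- case: (Y \subset X) => //= _; apply: (runs_weaken (T := 1) (Q := _)); [|by []|by move=> ?; apply].
  by apply: runs_skip; exists 1; rewrite mul0n addn0.
Qed.

(** * The table of stored sets with their parents: duplicates and insertion *)

Notation table := (seq ({set 'I_n} * nat)).

Definition records_at (m : nat -> nat) (S : table) :=
  forall q, q < size S ->
  record_at m (address q) (nth (set0, 0) S q).1 (nth (set0, 0) S q).2.

Definition level (S : table) i := count (fun r => order r.1 == i) S.
Definition occurrences (S : table) X := count (fun r => r.1 == X) S.

Lemma records_frame m m' S t : size S <= t -> (forall a, a < address t -> m' a = m a) ->
  records_at m S -> records_at m' S.
Proof.
move=> St E mS q qS; have := address_lt (leq_trans qS St) => qa.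
case: (mS q qS) => m0 m1 mM mD; split; try by rewrite E //; lia.
- by move=> u; have := ltn_ord u => un; rewrite E ?mM //; lia.
- by move=> u; have := ltn_ord u => un; rewrite E ?mD //; lia.
Qed.

(** The factor of [24 * n + 20] is the number of records of the same size, not [size S]; this keeps
    the total time quadratic in [n]. *)
Lemma runs_scan h a p b v np u x pq m (S : table) X par :
  records_at m S -> record_at m np X par ->
  size S <= n.+1 * G -> np + 2 * n + 2 + 10 < B ->
  runs w scan_loop (NState (file h (size S) a p b v np u x 0 0 pq) m)
    (size S * 26 + level S (order X) * (24 * n + 20) + 5)
    (fun ns => exists u' x' pq', ns = NState (file h (size S) a p b v np u' x'
       (level S (order X) + occurrences S X * G) (size S) pq') m).
Proof.
move=> mS mX SG npB.
(* The value of [rc] after [j] records: 1 for each set of the same size and [G] more for each equal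
   set. *)
pose c j := level (take j S) (order X) + occurrences (take j S) X * G.
pose same j := order (nth (set0, 0) S j).1 == order X.
pose I j ns := exists u' x' pq', ns = NState (file h (size S) a p b v np u' x' (c j) j pq') m.
have SB := tail_bound SG.
have cB j : c j + 1 + G < B.
  have h1 : level (take j S) (order X) <= size S.
    by apply: leq_trans (count_size _ _) _; rewrite size_take_min geq_minr.
  have h2 : occurrences (take j S) X <= size S.
    by apply: leq_trans (count_size _ _) _; rewrite size_take_min geq_minr.
  have h3 : occurrences (take j S) X * G <= n.+1 * G * G.
    by rewrite leq_mul2r (leq_trans h2 SG) orbT.
  move: (leq_trans h1 SG) h3; rewrite /c.
  move: (level _ _) (occurrences _ _ * G) B_cnt => l o; rewrite mulSn mulnS; lia.
apply: (runs_weaken (T := \sum_(0 <= j < size S) (17 + same j * (24 * n + 20) + 9) + 5)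
  (Q := I (size S))).
- apply: (runs_for_ord BE (I := I)) => //.
  + lia.
  + by exists u, x, pq; rewrite /c take0.
  + by move=> j ns [u' [x' [pq' ->]]].
  move=> i ns [u' [x' [pq' ->]]]; have iS := ltn_ord i; have mi := mS i iS.
  have iG : i <= n.+1 * G by lia.
  have iB := address_bound iG; have si : i * (2 * n + 2) <= address i by rewrite leq_addl.
  have E0 : m (address i) = order (nth (set0, 0) S i).1 by case: mi.
  have EX : m np = order X by case: mX.
  have Xn := cardn X; have Yn := cardn (nth (set0, 0) S i).1.
  set Y := (nth (set0, 0) S i).1 in mi E0 Yn *.
  have cS : c i.+1 = c i + (order Y == order X) + (Y == X) * G.
    rewrite /c (take_nth (set0, 0)) // /level /occurrences -!cats1 !count_cat /= -/Y.
    by rewrite !addn0 mulnDl addnACA addnA.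
  apply: (runs_weaken (T := 6 + (1 + 4 + (1 + 4 + (1 + same i * (24 * n + 20))))) (Q := _));
    [|lia|by move=> ?; apply].
  apply: runs_seq; apply: (runs_assign BE) => /=; first by fits; rewrite /address in iB si; lia.
  rewrite -/(address i).
  apply: (runs_if BE (T := 1 + 4 + (1 + same i * (24 * n + 20)))) => /=; [by rewrite E0; fits|by rewrite EX; fits| |].
  + rewrite E0 EX => le1.
    apply: (runs_if BE (T := 1 + same i * (24 * n + 20))) => /=; [by rewrite EX; fits|by rewrite E0; fits| |].
    * rewrite E0 EX => le2; have eqo : order Y = order X by lia.
      rewrite /same -/Y eqo eqxx mul1n.
      apply: runs_weaken; [by apply: runs_compare mX mi _ _ _; [lia|lia|apply: cB]|lia|].
      move=> ns' [x1 ->]; split=> //; exists n, x1, (address i).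
      rewrite /= cS eqo eqxx; congr (NState (file _ _ _ _ _ _ _ _ _ (_ + _ * G) _ _) _).
      by rewrite eqEcard -!/(order _) eqo leqnn andbT.
    * rewrite E0 EX => gt.
      apply: (runs_weaken (T := 1) (Q := _)); [|lia|by move=> ?; apply].
      apply: runs_skip; split=> //; exists u', x', (address i); rewrite /= cS.
      have nE : order Y != order X by lia.
      have nYX : Y != X by apply: contraNneq nE => ->.
      by rewrite (negPf nE) (negPf nYX) !addn0.
  + rewrite E0 EX => gt.
    apply: (runs_weaken (T := 1) (Q := _)); [|lia|by move=> ?; apply].
    apply: runs_skip; split=> //; exists u', x', (address i); rewrite /= cS.
    have nE : order Y != order X by lia.
    have nYX : Y != X by apply: contraNneq nE => ->.
    by rewrite (negPf nE) (negPf nYX) !addn0.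
- rewrite (eq_bigr (fun j => 26 + same j * (24 * n + 20))); last by move=> j _; lia.
  rewrite big_split /= sum_nat_const_nat -big_distrl /= subn0 !leq_add // leq_mul2r; apply/orP; right.
  rewrite /level -sum1_count [leqRHS]big_mkcond (big_nth (set0, 0)) /=.
  by apply: leq_sum => j _; rewrite /same; case: (_ == _).
- by move=> ns [u' [x' [pq' ->]]]; exists u', x', pq'; rewrite /c take_size.
Qed.

Definition add_state (S : table) h X : table :=
  if (occurrences S X == 0) && (level S (order X) < G) then rcons S (X, h) else S.

Lemma runs_expand h a b np u x c q pq m (S : table) (v : 'I_n) :
  let X := (nth (set0, 0) S h).1 in
  let S' := add_state S h (X :|: nbh e v) in
  matrix_at m -> records_at m S -> h < size S -> (nth (set0, 0) S h).2 < B ->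
  size S <= n.+1 * G -> (forall i, level S i <= G) ->
  runs w expand (NState (file h (size S) a (address h) b v np u x c q pq) m)
    (59 * n + dfc e X v * (32 * n + 14) + size S * 26 + G * (24 * n + 20) + 90)
    (fun ns => exists np' u' x' c' q' pq' m',
      [/\ ns = NState (file h (size S') a (address h) b v np' u' x' c' q' pq') m',
          matrix_at m' & records_at m' S']).
Proof.
move=> X S' mA mS hS parB SG lG; have SB := tail_bound SG; have aB := address_bound SG.
set lv := level S (order (X :|: nbh e v)).
apply: (runs_weaken (T := 59 * n + dfc e X v * (32 * n + 14) + 72 + (2 + (2 +
   (size S * 26 + lv * (24 * n + 20) + 5 + (1 + 1 + 1 + 1 + 4).+1)))) (Q := _));
   last by move=> ?; apply.
  apply: runs_seq; apply: runs_weaken; [exact: runs_new_record mA (mS _ hS) parB hS SG|by []|].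
  move=> ns [u1 [x1 [m1 [-> mX' fr1]]]].
  have mS1 : records_at m1 S := records_frame (leqnn _) fr1 mS.
  have mA1 : matrix_at m1.
    by apply: matrix_frame mA => z zn; apply: fr1; apply: leq_trans zn _; rewrite leq_addr.
  apply: runs_seq; apply: (runs_assign BE) => /=; first by fits.
  apply: runs_seq; apply: (runs_assign BE) => /=; first by fits.
  apply: runs_seq; apply: runs_weaken; [apply: runs_scan mS1 mX' SG _; lia|by []|].
  move=> ns1 [u2 [x2 [pq2 ->]]]; rewrite -/lv.
  have cB : lv + occurrences S (X :|: nbh e v) * G + 10 < B.
    have h1 : lv <= n.+1 * G by apply: leq_trans (count_size _ _) SG.
    have h2 : occurrences S (X :|: nbh e v) * G <= n.+1 * G * G.
      by rewrite leq_mul2r (leq_trans (count_size _ _) SG) orbT.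
    move: lv (occurrences _ _ * G) B_cnt h1 h2 => l o; rewrite mulSn mulnS; lia.
  have GB : G < B by move: B_cnt; lia.
  have [C EC] : exists C, lv + occurrences S (X :|: nbh e v) * G = C by eexists.
  rewrite EC in cB *; apply: (runs_if BE (T := 4)) => /=; [by fits|by fits| |]; rewrite addn1 => cG; rewrite -EC in cG.
  - have add : (occurrences S (X :|: nbh e v) == 0) && (lv < G).
      by case: (occurrences _ _) cG => [|o]; [rewrite mul0n addn0|rewrite mulSn; lia].
    apply: (runs_assign BE); first by fits.
    do 6 eexists; exists m1; split; last 1 first.
    + rewrite /S' /add_state add => i; rewrite size_rcons nth_rcons ltnS leq_eqVlt.
      have [->|iS] := eqVneq i (size S); first by rewrite ltnn.
      by move=> /= iS'; rewrite iS'; apply: mS1.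
    + by rewrite /S' /add_state add size_rcons /= addn1; reflexivity.
    + by [].
  - have add : (occurrences S (X :|: nbh e v) == 0) && (lv < G) = false.
      by case: (occurrences _ _) cG => [|o]; [rewrite mul0n addn0; lia|].
    apply: (runs_weaken (T := 1) (Q := _)); [|by []|by move=> ?; apply].
    apply: runs_skip; do 6 eexists; exists m1.
    by rewrite /S' /add_state add; split; first by reflexivity.
have := lG (order (X :|: nbh e v)); rewrite -/lv => lvG.
have : lv * (24 * n + 20) <= G * (24 * n + 20) by rewrite leq_mul2r lvG orbT.
set D := dfc e X v * _; set L := lv * _; set G' := G * (24 * n + 20); set S26 := _ * 26; lia.
Qed.

Lemma runs_boundary h t a p v np x c q pq m X par :
  record_at m p X par -> p + 2 * n + 2 + 10 < B ->
  runs w boundary_loop (NState (file h t a p 0 v np 0 x c q pq) m) (30 * n + 5)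
    (fun ns => ns = NState (file h t a p (order (X :\: core e X)) v np n x c q pq) m).
Proof.
move=> mX pB; set A := X :\: core e X.
pose I j ns := ns = NState (file h t a p (order (upto A j)) v np j x c q pq) m.
apply: (runs_weaken (T := \sum_(0 <= j < n) (21 + 9) + 5) (Q := I n)) => //.
- apply: (runs_for_ord BE (I := I)) => //.
  + lia.
  + by rewrite /I upto0 /order cards0.
  + by move=> j ns ->.
  move=> i ns ->; have := ltn_ord i => i_n.
  have Mi := record_mark i mX; have Di := record_defi i mX; have Dn := dfc_le X i.
  have oA := cardn (upto A i).
  have iA : (i \in A) = (0 < (i \in X) * dfc e X i).
    by rewrite in_setD -dfc_eq0 lt0n muln_eq0 negb_or andbC; case: (i \in X).
  have S : order (upto A i.+1) = order (upto A i) + (i \in A).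
    rewrite uptoS; case: ifP => // _; last by rewrite addn0.
    by rewrite /order cardsU1 inE ltnn andbF addnC.
  have MDn : (i \in X) * dfc e X i <= n by case: (i \in X); rewrite ?mul1n ?mul0n.
  apply: (runs_if BE (T := 4)) => /=; rewrite ?Mi ?Di.
  + by fits.
  + by fits; case: (i \in X); lia.
  + rewrite -iA => {}iA; apply: (runs_assign BE); first by fits.
    by split=> //=; rewrite /I S iA.
  + rewrite ltnNge -iA => /negPf {}iA.
    apply: (runs_weaken (T := 1) (Q := _)); [|by []|by move=> ?; apply].
    by apply: runs_skip; split=> //=; rewrite /I S iA addn0.
- by rewrite sum_nat_const_nat; lia.
- by move=> ns ->; rewrite upton.
Qed.

(** * Invariants of the table *)

Lemma level_rcons S r i : level (rcons S r) i = level S i + (order r.1 == i).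
Proof. by rewrite /level -cats1 count_cat /= addn0. Qed.

Lemma size_level S : size S = \sum_(i < n.+1) level S i.
Proof.
elim/last_ind: S => [|S r IH]; first by rewrite big1.
under eq_bigr do rewrite level_rcons.
rewrite size_rcons big_split /= -IH -addn1; congr (_ + _).
have rn : order r.1 < n.+1 by rewrite ltnS cardn.
rewrite (bigD1 (Ordinal rn)) //= eqxx big1 // => i /negPf ir.
by rewrite -[order _]/(nat_of_ord (Ordinal rn)) (inj_eq val_inj) eq_sym ir.
Qed.

(** The default [(set0, 1)] differs from the required entry, so the first clause also excludes the
    empty table. The last clause lets the parent pointers be followed back to record 0 by admissible
    steps. *)
Definition valid (S : table) :=
  [/\ nth (set0, 1) S 0 = (set0, 0), forall X, occurrences S X <= 1,
      forall i, level S i <= G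
    & forall q, 0 < q -> q < size S ->
      exists v, [/\ (nth (set0, 0) S q).2 < q,
        admissible e k (nth (set0, 0) S (nth (set0, 0) S q).2).1 v
      & (nth (set0, 0) S q).1 = (nth (set0, 0) S (nth (set0, 0) S q).2).1 :|: nbh e v]].

Lemma valid_size S : valid S -> size S <= n.+1 * G.
Proof.
case=> _ _ lG _; rewrite size_level -[n.+1 in leqRHS]card_ord -sum_nat_const.
by apply: leq_sum => i _; apply: lG.
Qed.

Lemma valid_gt0 S : valid S -> 0 < size S.
Proof. by case=> + _ _ _; case: S. Qed.

Lemma valid_nth0 S : valid S -> nth (set0, 0) S 0 = (set0, 0).
Proof. by case; case: S. Qed.

Lemma valid_parent S q : valid S -> q < size S -> (nth (set0, 0) S q).2 <= q.
Proof.
move=> vS; case: q => [|q] qS; first by rewrite valid_nth0.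
by case: vS => _ _ _ /(_ q.+1 isT qS)[v [/ltnW]].
Qed.

Lemma valid_good S q : valid S -> q < size S -> good e k (nth (set0, 0) S q).1.
Proof.
move=> vS; elim/ltn_ind: q => -[_ _|q IH qS]; first by rewrite valid_nth0 ?good0.
case: (vS) => _ _ _ /(_ q.+1 isT qS)[v [pq adm ->]].
by apply: good_step adm; apply: IH => //; apply: ltn_trans qS.
Qed.

Lemma valid_add S h v : valid S -> h < size S -> admissible e k (nth (set0, 0) S h).1 v ->
  valid (add_state S h ((nth (set0, 0) S h).1 :|: nbh e v)).
Proof.
move=> vS hS adm; rewrite /add_state; case: ifP => // /andP[/eqP occ lv].
set X := _ :|: _ in occ lv *; case: (vS) => S0 Socc Slv Sstep; split.
- by rewrite nth_rcons (valid_gt0 vS).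
- move=> Y; rewrite /occurrences -cats1 count_cat /= addn0 -/(occurrences S Y).
  by case: eqP => [<-|_]; rewrite ?occ // addn0 Socc.
- by move=> i; rewrite level_rcons /=; case: eqP => [<-|_]; rewrite ?addn1 // addn0 Slv.
move=> q q0; rewrite size_rcons ltnS leq_eqVlt => /orP[/eqP->|qS].
  by exists v; rewrite !nth_rcons ltnn eqxx /= hS.
have [u [pq admq Eq]] := Sstep q q0 qS; exists u; rewrite !nth_rcons qS.
by rewrite (ltn_trans pq qS); split.
Qed.

Lemma add_state_prefix S h X q : q < size S ->
  nth (set0, 0) (add_state S h X) q = nth (set0, 0) S q.
Proof. by move=> qS; rewrite /add_state; case: ifP => // _; rewrite nth_rcons qS. Qed.

Lemma size_add_state S h X : size S <= size (add_state S h X).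
Proof. by rewrite /add_state; case: ifP => // _; rewrite size_rcons. Qed.

Lemma occ_sub S h X Y : 0 < occurrences S Y -> 0 < occurrences (add_state S h X) Y.
Proof.
rewrite /add_state; case: ifP => // _.
by rewrite /occurrences -cats1 count_cat => h0; rewrite addn_gt0 h0.
Qed.

Definition feasible := exists D : seq {set 'I_n},
  path_decomposition e D /\ (forall W, W \in D -> #|W| <= k.+1).

Lemma occ_gt0P S X : reflect (exists2 q, q < size S & (nth (set0, 0) S q).1 = X) (0 < occurrences S X).
Proof.
rewrite /occurrences -has_count; apply: (iffP (has_nthP (set0, 0))).
  by case=> q qS /eqP; exists q.
by case=> q qS <-; exists q.
Qed.

(** * Completeness of the search *)

Hypotheses (EG : G = 2 ^ (10 * k)) (sc : semi_complete e).

(* If the level of the new set is full, then it consists of [G] good sets, and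
   the new set would be one more. *)
Lemma add_state_occ S h v : feasible ->
  valid S -> h < size S -> admissible e k (nth (set0, 0) S h).1 v ->
  0 < occurrences (add_state S h ((nth (set0, 0) S h).1 :|: nbh e v))
        ((nth (set0, 0) S h).1 :|: nbh e v).
Proof.
move=> [D [pD wD]] vS hS adm; set X := _ :|: _; rewrite /add_state.
case: ifP => [_|/negbT]; first by rewrite /occurrences -cats1 count_cat /= eqxx addn_gt0 orbT.
rewrite negb_and -lt0n => /orP[//|]; rewrite -leqNgt => full.
case: posnP => // occ0; exfalso.
have gX : good e k X by apply: good_step adm; apply: valid_good.
have := card_good_level sc (order X) pD wD; rewrite -EG leqNgt => /negP; apply.
pose L := [seq r.1 | r <- S & order r.1 == order X].
have uL : uniq L.
  rewrite /L -(filter_map _ (fun Y : {set 'I_n} => order Y == order X)) filter_uniq //.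
  apply: count_mem_uniq => Y; rewrite count_map -/(occurrences S Y).
  case: vS => _ /(_ Y) oY _ _; have := has_count (pred1 Y) [seq r.1 | r <- S].
  rewrite has_pred1 count_map -/(occurrences S Y) => ->; lia.
have XL : X \notin L.
  apply/negP => /mapP[r]; rewrite mem_filter => /andP[_ rS] E.
  by move/eqP: occ0; rewrite -leqn0 leqNgt -has_count => /hasP; apply; exists r; rewrite // E.
apply: (@leq_trans #|[set Y in X :: L]|).
  rewrite cardsE (card_uniqP _) /= ?XL // ltnS (leq_trans full) //.
  by rewrite size_map size_filter.
apply: subset_leq_card; apply/subsetP=> Y; rewrite !inE => /orP[/eqP->|].
  by rewrite gX eqxx.
case/mapP=> r; rewrite mem_filter => /andP[ro rS] ->; rewrite -/(order r.1) ro andbT.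
by have /nthP := rS => /(_ (set0, 0))[q qS <-]; apply: valid_good.
Qed.

(** Closure is claimed only in the feasible case: otherwise a level may overflow and successors be
    dropped. *)
Definition closed_below (S : table) h := feasible ->
  forall q v, q < h -> admissible e k (nth (set0, 0) S q).1 v ->
    0 < occurrences S ((nth (set0, 0) S q).1 :|: nbh e v).

Definition expand_time :=
  59 * n + k.+1 * (32 * n + 14) + n.+1 * G * 26 + G * (24 * n + 20) + 90.

(** By [card_admissible] at most [3 k + 2] vertices cause a call of [expand]; the others cost only
    tests. *)
Lemma runs_expand_loop h a np u x c q pq m (S : table) :
  let X := (nth (set0, 0) S h).1 in
  matrix_at m -> records_at m S -> h < size S -> valid S -> closed_below S h ->
  runs w expand_loop
    (NState (file h (size S) a (address h) (order (X :\: core e X)) 0 np u x c q pq) m)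
    (n * 32 + (3 * k + 2) * expand_time + 5)
    (fun ns => exists np' u' x' c' q' pq' m' S',
      [/\ ns = NState (file h (size S') a (address h) (order (X :\: core e X)) n
                 np' u' x' c' q' pq') m',
          matrix_at m' /\ records_at m' S', valid S' /\ size S <= size S',
          forall i, i < size S -> nth (set0, 0) S' i = nth (set0, 0) S i
        & closed_below S' h.+1]).
Proof.
move=> X mA mS hS vS clS; set b := order (X :\: core e X).
pose I j ns := exists np' u' x' c' q' pq' m' S',
      [/\ ns = NState (file h (size S') a (address h) b j np' u' x' c' q' pq') m',
          matrix_at m' /\ records_at m' S', valid S' /\ size S <= size S',
          forall i, i < size S -> nth (set0, 0) S' i = nth (set0, 0) S i
        & closed_below S' h /\ (feasible -> forall v : 'I_n, v < j -> admissible e k X v ->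
            0 < occurrences S' (X :|: nbh e v))].
pose Adm := [set v | admissible e k X v].
have SG := valid_size vS; have SB := tail_bound SG.
have bn : b <= n := cardn _.
have bk : b <= k by have /andP[_] := valid_good vS hS.
have hG : h <= n.+1 * G by apply: leq_trans (ltnW hS) SG.
have hB := address_bound hG; have hT := tail_bound hG.
apply: (runs_weaken (T := \sum_(0 <= j < n) (23 + memn Adm j * expand_time + 9) + 5) (Q := I n)).
- apply: (runs_for_ord BE (I := I)) => //.
  + lia.
  + by do 7 eexists; exists S; split; first by reflexivity.
  + by move=> j ns [np' [u' [x' [c' [q' [pq' [m' [S' [-> _ _ _ _]]]]]]]]].
  move=> v ns [np' [u' [x' [c' [q' [pq' [m' [S' [-> [mA' mS'] [vS' SS'] pre [cl new]]]]]]]]]].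
  have hS' := leq_trans hS SS'.
  have EX : (nth (set0, 0) S' h).1 = X by rewrite pre.
  have mh := mS' h hS'; rewrite EX in mh.
  have Dv := record_defi v mh; have Dn := dfc_le X v; have v_n := ltn_ord v.
  apply: (runs_weaken (T := (1 + 8 + (10 + 1 + (1 + (v \in Adm) * expand_time)).+1).+1) (Q := _));
    [|by rewrite memn_ord; move: (_ * expand_time) => z; lia|by move=> ?; apply].
  have skip : v \notin Adm -> runs w Skip
     (NState (file h (size S') a (address h) b v np' u' x' c' q' pq') m') 1
     (fun ns' => nth 0 (nregs ns') 8 = v /\
       I v.+1 (NState (set_nth 0 (nregs ns') 8 v.+1) (nmem ns'))).
    move=> vA; apply: runs_skip; split=> //.
    exists np', u', x', c', q', pq', m', S'; split=> //; split=> // fe y.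
    rewrite ltnS leq_eqVlt => /orP[/eqP/val_inj ->|]; last exact: new.
    by move: vA; rewrite inE => /negPf ->.
  apply: (runs_if BE (T := (10 + 1 + (1 + (v \in Adm) * expand_time)).+1)) => /=; rewrite ?Dv.
  + by fits.
  + by fits.
  + move=> d0; apply: (runs_if BE (T := 1 + (v \in Adm) * expand_time)) => /=; rewrite ?Dv.
    * by fits.
    * by move: k_G B_cnt; fits.
    * move=> dk; have vA : v \in Adm by rewrite inE /admissible d0 /= -/(order _) -/b.
      have adm : admissible e k (nth (set0, 0) S' h).1 v by rewrite EX; rewrite inE in vA.
      have SG' := valid_size vS'.
      have parB : (nth (set0, 0) S' h).2 < B.
        by apply: leq_ltn_trans (valid_parent vS' hS') _; lia.
      have lG : forall i, level S' i <= G by case: vS'.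
      rewrite vA mul1n; apply: runs_weaken; [exact: runs_expand mA' mS' hS' parB SG' lG| |].
        rewrite EX /expand_time.
        have dk1 : dfc e X v <= k.+1 by lia.
        have h1 : dfc e X v * (32 * n + 14) <= k.+1 * (32 * n + 14) by rewrite leq_mul2r dk1 orbT.
        have h2 : size S' * 26 <= n.+1 * G * 26 by rewrite leq_mul2r SG' orbT.
        by rewrite leqW // !leq_add.
      rewrite EX => ns' [np2 [u2 [x2 [c2 [q2 [pq2 [m2 [-> mA2 mS2]]]]]]]]; split=> //.
      do 6 eexists; exists m2; eexists; split; [by reflexivity|by split| | |].
      - split; first by rewrite -EX; apply: valid_add.
        exact: leq_trans SS' (size_add_state _ _ _).
      - by move=> i iS; rewrite add_state_prefix ?pre //; apply: leq_trans SS'.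
      split.
        move=> fe q1 v1 qh; have qS' := ltn_trans qh hS'.
        by rewrite add_state_prefix // => /(cl fe q1 v1 qh); apply: occ_sub.
      move=> fe y; rewrite ltnS leq_eqVlt => /orP[/eqP/val_inj ->|yv] adm'.
        by rewrite -EX; apply: add_state_occ.
      exact/occ_sub/new.
    * move=> dk; apply: runs_weaken; [apply: skip|by []|by move=> ?; apply].
      by rewrite inE /admissible d0 /= -/(order _) -/b -ltnNge.
  + move=> d0; apply: runs_weaken; [apply: skip|by []|by move=> ?; apply].
    by rewrite inE /admissible; move: d0; case: (dfc e X v).
- rewrite (eq_bigr (fun j => 32 + memn Adm j * expand_time)); last by move=> j _; lia.
  by rewrite sum_memn !leq_add // leq_mul2r (card_admissible sc bk) orbT.
- move=> ns [np' [u' [x' [c' [q' [pq' [m' [S' [-> mm vv pre [cl new]]]]]]]]]].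
  exists np', u', x', c', q', pq', m', S'; split=> // fe i y.
  rewrite ltnS leq_eqVlt => /orP[/eqP->|]; last exact: cl.
  by rewrite pre // => /new; apply.
Qed.

(** The number 0 can mean that nothing was found: record 0 holds the empty set, which is not [setT]
    as [0 < n]. *)
Definition goal_at (S : table) h a :=
  if a == 0 then forall q, q < h -> (nth (set0, 0) S q).1 != setT
  else a < h /\ (nth (set0, 0) S a).1 = setT.

Definition visit_time := 62 * n + (3 * k + 2) * expand_time + 30.

Lemma runs_visit h a p b v np u x c q pq m (S : table) :
  matrix_at m -> records_at m S -> h < size S -> valid S -> closed_below S h -> goal_at S h a ->
  runs w visit (NState (file h (size S) a p b v np u x c q pq) m) visit_time
    (fun ns => exists a' p' b' v' np' u' x' c' q' pq' m' S',
      [/\ ns = NState (file h (size S') a' p' b' v' np' u' x' c' q' pq') m',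
          matrix_at m' /\ records_at m' S', valid S' /\ h < size S', goal_at S' h.+1 a'
        & closed_below S' h.+1]).
Proof.
move=> mA mS hS vS clS gS; have SG := valid_size vS; have SB := tail_bound SG.
have hG : h <= n.+1 * G by apply: leq_trans (ltnW hS) SG.
have hB := address_bound hG; have hT := tail_bound hG.
have hB2 : n * n + h * (2 * n + 2) < B by rewrite /address in hB; lia.
have hsz : h * (2 * n + 2) <= n * n + h * (2 * n + 2) by rewrite leq_addl.
set X := (nth (set0, 0) S h).1; have Xn := cardn X.
apply: (runs_weaken (T := 6 + (6 + (2 + (2 + (30 * n + 5 + (2 + (n * 32 + (3 * k + 2) * expand_time + 5))))))) (Q := _));
  [|by rewrite /visit_time; lia|by move=> ?; apply].
apply: runs_seq; apply: (runs_assign BE) => /=; first by fits.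
rewrite -/(address h); set a' := if n <= order X then h else a.
apply: runs_seq.
have E0 : m (address h) = order X by case: (mS h hS).
apply: (runs_weaken (T := 6) (Q := fun ns => ns = NState (file h (size S) a' (address h) b v np u x c q pq) m)) => //.
  apply: (runs_if BE (T := 2)) => /=; rewrite ?E0.
  - by fits.
  - by fits.
  - move=> nX; apply: (runs_assign BE); first by fits.
    by rewrite /a' nX.
  - rewrite ltnNge => /negPf nX; apply: (runs_weaken (T := 1) (Q := _)); [|by []|by move=> ?; apply].
    by apply: runs_skip; rewrite /a' nX.
move=> ns ->; apply: runs_seq; apply: (runs_assign BE) => /=; first by fits.
apply: runs_seq; apply: (runs_assign BE) => /=; first by fits.
apply: runs_seq; apply: runs_weaken; [apply: runs_boundary (mS h hS) _; lia|exact: leqnn|].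
move=> _ ->; apply: runs_seq; apply: (runs_assign BE) => /=; first by fits.
apply: runs_weaken; [exact: runs_expand_loop mA mS hS vS clS|exact: leqnn|].
move=> ns1 [np' [u' [x' [c' [q' [pq' [m' [S' [-> mm [vS' SS'] pre cl]]]]]]]]].
do 10 eexists; exists m', S'; split; [by reflexivity|by []| | |by []].
  by split=> //; exact: leq_trans hS SS'.
have XT : (n <= order X) = (X == setT) by rewrite eqEcard subsetT cardsT card_ord.
rewrite /a' XT /goal_at; have [ET|NT] := eqVneq X setT.
  case: posnP => [h0|hp]; last by rewrite pre.
  by move: ET; rewrite /X h0 valid_nth0 //= => /setP/(_ (Ordinal n_gt0)); rewrite !inE.
move: gS; rewrite /goal_at; case: posnP => [a0 gS qi|ap [ah aT]]; last first.
  by split; [apply: ltn_trans ah _|rewrite pre // (ltn_trans ah)].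
rewrite ltnS leq_eqVlt => /orP[/eqP->|qh]; first by rewrite pre.
by rewrite pre ?gS // (ltn_trans qh).
Qed.

(** Once every record has been expanded, occurring in the table is a property closed under
    admissible steps, and [reach_setT] applies to it. *)
Lemma closed_goal S h : valid S -> closed_below S h -> size S <= h -> feasible ->
  exists2 q, q < size S & (nth (set0, 0) S q).1 = setT.
Proof.
move=> vS cl Sh fe; case: (fe) => D [pD wD]; apply/occ_gt0P.
apply: (reach_setT pD wD (Q := fun X => 0 < occurrences S X)) => [|X v /occ_gt0P[q qS <-] adm].
  by apply/occ_gt0P; exists 0; rewrite ?valid_nth0 ?valid_gt0.
exact: cl fe _ _ (leq_trans qS Sh) adm.
Qed.

Definition search_time := n.+1 * G * (visit_time + 9) + 5.

Lemma runs_search p b v np u x c q pq m :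
  matrix_at m -> record_at m (address 0) set0 0 ->
  runs w search_loop (NState (file 0 1 0 p b v np u x c q pq) m) search_time
    (fun ns => exists h a p' b' v' np' u' x' c' q' pq' m' S',
      [/\ ns = NState (file h (size S') a p' b' v' np' u' x' c' q' pq') m',
          records_at m' S', valid S'
        & if a == 0 then ~ feasible else a < size S' /\ (nth (set0, 0) S' a).1 = setT]).
Proof.
move=> mA m0.
pose I h ns := exists a p' b' v' np' u' x' c' q' pq' m' S',
      [/\ ns = NState (file h (size S') a p' b' v' np' u' x' c' q' pq') m',
          matrix_at m' /\ records_at m' S', valid S' /\ h <= size S', goal_at S' h a
        & closed_below S' h].
apply: (runs_weaken (T := \sum_(0 <= j < n.+1 * G) (visit_time + 4 + 5) + 5) (Q := _));
  [|by rewrite sum_nat_const_nat subn0 /search_time; move: visit_time (_ * G) => V N; lia|by move=> ?; apply].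
apply: (runs_while BE (I := I)) => //.
  do 11 eexists; exists [:: (set0, 0)]; split; [by reflexivity| | |by []|by []].
    by split=> // -[].
  split=> //; split=> //.
  - by move=> X; rewrite /occurrences /= addn0; case: eqP.
  - by move=> i; rewrite /level /= addn0; case: eqP.
  - by case.
move=> h ns [a [p' [b' [v' [np' [u' [x' [c' [q' [pq' [m' [S' [-> [mA' mS'] [vS' hS'] gS clS]]]]]]]]]]]]].
have SG := valid_size vS'; have SB := tail_bound SG.
split=> /=; [by fits|by fits|].
rewrite addn1; case: (boolP (h < size S')) => [hS|]; last rewrite -leqNgt => hS.
  split; first exact: leq_trans hS SG.
  apply: runs_seq; apply: runs_weaken; [exact: runs_visit mA' mS' hS vS' clS gS|exact: leqnn|].
  move=> ns1 [a2 [p2 [b2 [v2 [np2 [u2 [x2 [c2 [q2 [pq2 [m2 [S2 [-> mm [vS2 hS2] g2 cl2]]]]]]]]]]]]].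
  apply: (runs_assign BE) => /=; first by have := tail_bound (valid_size vS2); fits.
  by rewrite addn1; do 11 eexists; exists S2; split; [by reflexivity| | | |].
exists h, a, p', b', v', np', u', x', c', q', pq', m', S'; split=> //.
move: gS; rewrite /goal_at; case: posnP => [a0 g|_ [ah aT]]; last first.
  by split=> //; apply: leq_trans ah hS'.
move=> fe; have [y yS yT] := closed_goal vS' clS hS fe.
by have := g y (leq_trans yS hS); rewrite yT eqxx.
Qed.

(** * Writing the decomposition *)

Definition stores (m : nat -> nat) (a : nat) (s : seq nat) :=
  forall i, i < size s -> m (a + i) = nth 0 s i.

Lemma stores_cons m a x s : m a = x -> stores m a.+1 s -> stores m a (x :: s).
Proof. by move=> mx ms [|i] /= hi; rewrite ?addn0 // addnS -addSn ms. Qed.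

Lemma stores_frame m m' a s : (forall z, a <= z -> m' z = m z) -> stores m a s -> stores m' a s.
Proof. by move=> E ms i hi; rewrite E ?ms // leq_addr. Qed.

Lemma stores_cat m a s1 s2 :
  stores m a s1 -> stores m (a + size s1) s2 -> stores m a (s1 ++ s2).
Proof.
move=> h1 h2 i; rewrite size_cat nth_cat => hs; case: ltnP => hi; first exact: h1.
by rewrite -h2; [congr (m _)|]; lia.
Qed.

Lemma runs_bag h t a p b v np c q pq m X Y parX parY :
  record_at m p X parX -> record_at m pq Y parY ->
  p + 3 * n + 3 <= np -> pq + 3 * n + 3 <= np -> np < B ->
  runs w bag_loop (NState (file h t a p b v np 0 0 c q pq) m) (37 * n + 5)
    (fun ns => exists m' l,
      [/\ ns = NState (file h t a p b v (np - size l) n (size l) c q pq) m',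
          uniq l /\ [set i in l] = Y :\: core e X, size l <= n,
          stores m' (np - size l) [seq val i | i <- l]
        & forall z, ~~ (np - size l <= z < np) -> m' z = m z]).
Proof.
move=> mX mY pnp pqnp npB; set A := Y :\: core e X.
pose I j ns := exists m' (l : seq 'I_n),
      [/\ ns = NState (file h t a p b v (np - size l) j (size l) c q pq) m',
          uniq l /\ [set i in l] = upto A j, size l <= j,
          stores m' (np - size l) [seq val i | i <- l]
        & forall z, ~~ (np - size l <= z < np) -> m' z = m z].
apply: (runs_weaken (T := \sum_(0 <= j < n) (28 + 9) + 5) (Q := I n)) => //.
- apply: (runs_for_ord BE (I := I)) => //.
  + lia.
  + exists m, [::]; rewrite /= subn0; split=> //; split=> //.
    by rewrite upto0; apply/setP=> y; rewrite !inE.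
  + by move=> j ns [m' [l [-> _ _ _ _]]].
  move=> i ns [m' [l [-> [ul El] szl st fr]]]; have i_n := ltn_ord i.
  have My := record_mark i mY; have Dx := record_defi i mX; have Dn := dfc_le X i.
  rewrite -fr in My; last by lia.
  rewrite -fr in Dx; last by lia.
  have MDn : (i \in Y) * dfc e X i <= n by case: (i \in Y); rewrite ?mul1n ?mul0n.
  have iA : (i \in A) = (0 < (i \in Y) * dfc e X i).
    by rewrite in_setD -dfc_eq0 lt0n muln_eq0 negb_or andbC; case: (i \in Y).
  have il : i \notin l.
    by have := in_set (mem l) i; rewrite El inE ltnn andbF /= => <-.
  apply: (runs_if BE (T := 4 + (3 + 4))) => /=; rewrite ?My ?Dx.
  + by fits.
  + by fits; case: (i \in Y); lia.
  + rewrite -iA => {}iA; apply: runs_seq; apply: (runs_assign BE) => /=; first by fits.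
    apply: runs_seq; apply: (runs_write BE) => /=; [by fits|by fits|].
    apply: (runs_assign BE) => /=; first by fits.
    have E : np - size l - 1 = np - (size l).+1 by lia.
    have E2 : (np - (size l).+1).+1 = np - size l by lia.
    rewrite E addn1; split=> //; exists (nupd m' (np - (size l).+1) i), (i :: l).
    split=> //=.
    * split; first by rewrite il.
      by rewrite uptoS iA set_cons El.
    * apply: stores_cons; first by rewrite /nupd eqxx.
      rewrite E2; apply: stores_frame st => z hz; by updates.
    * by move=> z hz; updates; apply: fr; lia.
  + rewrite ltnNge -iA => /negPf {}iA.
    apply: (runs_weaken (T := 1) (Q := _)); [|by []|by move=> ?; apply].
    apply: runs_skip; split=> //; exists m', l; split=> //.
      by rewrite uptoS iA.
    exact: leqW.
- by rewrite sum_nat_const_nat; lia.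
- by move=> ns [m' [l [-> [ul El] szl st fr]]]; exists m', l; rewrite upton in El.
Qed.

Definition bag_codes (L : seq (seq 'I_n)) : seq nat :=
  flatten [seq size l :: [seq val i | i <- l] | l <- L].

Definition output_time := n * (37 * n + 43) + 3.

Lemma runs_output_loop h t a p b v u x pq m (S : table) :
  records_at m S -> valid S -> a < size S -> t = size S ->
  (nth (set0, 0) S a).1 = setT ->
  runs w output_loop
    (NState (file h t a p b v (address t + n * n.+1 + 2) u x 0 a pq) m) output_time
    (fun ns => exists p' np u' x' pq' m' (L : seq (seq 'I_n)),
      [/\ ns = NState (file h t a p' b v np u' x' (size L) 0 pq') m',
          all uniq L, leads e k set0 [seq [set i in l] | l <- L],
          stores m' np (bag_codes L)
        & size L <= n /\ address t + 2 <= np <= address t + n * n.+1 + 2]).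
Proof.
move=> mS vS aS Et aT.
have tG : t <= n.+1 * G by rewrite Et; apply: valid_size.
have tB := address_bound tG; have tB2 := tail_bound tG.
(* [j] bags are written and [q] is the record reached. Passing to the parent lowers [order] by at
   least one, hence at most [n] bags; the lower bound on [np] reserves [n + 1] cells for each bag
   still to come. *)
pose I j ns := exists p' np u' x' q pq' m' (L : seq (seq 'I_n)),
      [/\ ns = NState (file h t a p' b v np u' x' j q pq') m' /\ size L = j,
          all uniq L /\ leads e k (nth (set0, 0) S q).1 [seq [set i in l] | l <- L],
          records_at m' S /\ stores m' np (bag_codes L),
          j + order (nth (set0, 0) S q).1 <= n /\ q < t
        & address t + order (nth (set0, 0) S q).1 * n.+1 + 2 <= np <= address t + n * n.+1 + 2].
apply: (runs_weaken (T := \sum_(0 <= j < n) (37 * n + 40 + 3) + 3) (Q := _));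
  [|by rewrite sum_nat_const_nat subn0 /output_time; lia|by move=> ?; apply].
apply: (runs_while BE (I := I)) => //.
  do 7 eexists; exists [::]; split; [by split; [reflexivity|]| |by split=> // i| |].
  - by split=> //; rewrite aT; constructor.
  - by rewrite Et; split=> //; apply: cardn.
  - by rewrite aT /order cardsT card_ord leqnn.
move=> j ns [p' [np [u' [x' [q [pq' [m' [L [[-> sL] [uL ld] [mS' st] [jq qt] /andP[np1 np2]]]]]]]]]].
split=> /=; [by fits|by fits; lia|].
have qS : q < size S by rewrite -Et.
case: (posnP q) => [q0|qp]; last first.
  case: (vS) => _ _ _ /(_ q qp qS)[y [rq adm Eq]].
  set r := (nth (set0, 0) S q).2 in rq adm Eq *; set X := (nth (set0, 0) S r).1 in adm Eq *.
  rewrite Eq card_stepn in jq np1; have d0 : 0 < dfc e X y by case/andP: adm.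
  have jn : j < n by lia.
  split=> //.
  have rS : r < size S by apply: ltn_trans qS.
  have mq := mS' q qS; have mr := mS' r rS.
  have qa := address_lt qt; have ra := address_lt (ltn_trans rq qt).
  have Eqs : q * (2 * n + 2) <= address q by rewrite leq_addl.
  have Ers : r * (2 * n + 2) <= address r by rewrite leq_addl.
  have Eqa : n * n + q * (2 * n + 2) = address q by [].
  have Era : n * n + r * (2 * n + 2) = address r by [].
  have mpar : m' (address q + 1) = r by rewrite addn1; case: mq.
  have np3 : address t + n.+1 + 2 <= np.
    by apply: leq_trans np1; rewrite leq_add2r leq_add2l leq_pmull // addn_gt0 d0 orbT.
  apply: (runs_weaken (T := 6 + (9 + (2 + (2 + (37 * n + 5 + (4 + (3 + (4 + 5)))))))) (Q := _));
    [|by lia|by move=> ?; apply].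
  apply: runs_seq; apply: (runs_assign BE) => /=; first by fits.
  rewrite Eqa.
  apply: runs_seq; apply: (runs_assign BE) => /=; first by rewrite mpar; fits.
  rewrite mpar Era.
  apply: runs_seq; apply: (runs_assign BE) => /=; first by fits.
  apply: runs_seq; apply: (runs_assign BE) => /=; first by fits.
  apply: runs_seq; apply: runs_weaken; [apply: runs_bag mr mq _ _ _; lia|exact: leqnn|].
  move=> ns1 [m1 [l [-> [ul El] ln st1 fr1]]].
  have [sl Esl] : exists sl, size l = sl by eexists.
  rewrite Esl in ln st1 fr1 *.
  apply: runs_seq; apply: (runs_assign BE) => /=; first by fits.
  apply: runs_seq; apply: (runs_write BE) => /=; [by fits|by fits|].
  apply: runs_seq; apply: (runs_assign BE) => /=; first by fits.
  have fr2 z : z < address t -> nupd m1 (np - sl - 1) sl z = m' z.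
    by move=> zt; updates; apply: fr1; lia.
  have mS2 : records_at (nupd m1 (np - sl - 1) sl) S.
    by apply: records_frame fr2 mS'; rewrite Et.
  have mpar2 : nupd m1 (np - sl - 1) sl (address q + 1) = r by rewrite fr2 //; lia.
  apply: (runs_assign BE); rewrite /= mpar2; first by fits.
  do 7 eexists; exists (l :: L); split.
  - by split; [rewrite addn1; reflexivity|rewrite /= sL].
  - rewrite /= ul uL; split=> //; rewrite El Eq; apply: leads_cons adm _.
    by rewrite -Eq.
  - split=> //; apply: stores_cons; first by rewrite /nupd eqxx Esl.
    have -> : (np - sl - 1).+1 = np - sl by lia.
    apply: stores_cat.
      by apply: stores_frame st1 => z hz; updates.
    rewrite size_map Esl subnK; last by lia.
    by apply: stores_frame st => z hz; updates; apply: fr1; lia.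
  - by split; [rewrite -/X; lia|apply: ltn_trans qt].
  - rewrite -/X; apply/andP; split; last by lia.
    have : (order X + 1) * n.+1 <= (order X + dfc e X y) * n.+1 by rewrite leq_mul2r leq_add2l d0 orbT.
    by rewrite mulnDl mul1n; lia.
move: ld; rewrite q0 valid_nth0 // => ld.
exists p', np, u', x', pq', m', L; split=> //; first by rewrite sL.
split; first by rewrite sL; apply: leq_trans jq; apply: leq_addr.
by rewrite np2 andbT; apply: leq_trans np1; rewrite leq_add2r leq_addr.
Qed.

Lemma runs_output h t a p b v np u x c q pq m (S : table) :
  records_at m S -> valid S -> a < size S -> t = size S ->
  (nth (set0, 0) S a).1 = setT ->
  runs w output (NState (file h t a p b v np u x c q pq) m) (output_time + 29)
    (fun ns => nth 0 (nregs ns) 0 = 1 /\ exists L : seq (seq 'I_n),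
      [/\ all uniq L, leads e k set0 [seq [set i in l] | l <- L]
        & stores (nmem ns) (nth 0 (nregs ns) 1) (size L :: bag_codes L)]).
Proof.
move=> mS vS aS Et aT.
have tG : t <= n.+1 * G by rewrite Et; apply: valid_size.
have aB : a < t by rewrite Et.
have tB := address_bound tG; have tB2 := tail_bound tG.
have Ets : t * (2 * n + 2) <= address t by rewrite leq_addl.
have Eta : n * n + t * (2 * n + 2) = address t by [].
have En : n * (n + 1) = n * n.+1 by rewrite addn1.
apply: (runs_weaken (T := 14 + (2 + (2 + (output_time + (4 + (3 + (2 + 2))))))) (Q := _));
  [|by lia|by move=> ?; apply].
apply: runs_seq; apply: (runs_assign BE) => /=; first by rewrite Eta En; fits.
rewrite Eta En.
apply: runs_seq; apply: (runs_assign BE) => /=; first by fits.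
apply: runs_seq; apply: (runs_assign BE) => /=; first by fits.
apply: runs_seq; apply: runs_weaken; [exact: runs_output_loop mS vS aS Et aT|exact: leqnn|].
move=> ns [p' [np' [u' [x' [pq' [m' [L [-> uL ld st [sL /andP[np1 np2]]]]]]]]]].
have [sz Esz] : exists sz, size L = sz by eexists.
rewrite Esz in sL *.
apply: runs_seq; apply: (runs_assign BE) => /=; first by fits.
apply: runs_seq; apply: (runs_write BE) => /=; [by fits|by fits|].
apply: runs_seq; apply: (runs_assign BE) => /=; first by fits.
apply: (runs_assign BE) => /=; first by fits.
split=> //; exists L; split=> //; apply: stores_cons; first by rewrite /nupd eqxx Esz.
have -> : (np' - 1).+1 = np' by lia.
by apply: stores_frame st => z hz; updates.
Qed.

(** * Initialisation and the whole program *)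

Definition preset (g u : nat) : seq nat :=
  [:: n; k; g; 0; 0; 0; 0; 0; 0; 0; u; 0; 0; 0; 0; n * n; 2 * n + 2].

Lemma runs_pow m :
  runs w pow_loop (NState (preset 1 0) m) (13 * k + 5)
    (fun ns => ns = NState (preset G k) m).
Proof.
pose I j ns := ns = NState (preset (2 ^ (10 * j)) j) m.
have kB : k.+1 + 1024 * G < B by move: k_G B_cnt; lia.
apply: (runs_weaken (T := \sum_(0 <= j < k) (4 + 9) + 5) (Q := I k)) => //.
- apply: (runs_for_ord BE (I := I)) => //.
  + lia.
  + by move=> j ns ->.
  move=> i ns ->.
  have E : 2 ^ (10 * i) * 1024 = 2 ^ (10 * i.+1) by rewrite (mulnS 10 i) (expnD 2 10 (10 * i)) [RHS]mulnC.
  have le : 2 ^ (10 * i.+1) <= G by rewrite EG leq_exp2l // leq_mul2l ltn_ord.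
  have [g Eg] : exists g, 2 ^ (10 * i) = g by eexists.
  have [g' Eg'] : exists g', 2 ^ (10 * i.+1) = g' by eexists.
  rewrite Eg Eg' in E le.
  apply: (runs_assign BE) => /=; rewrite Eg E; first by fits.
  by split=> //; rewrite /I Eg'.
- by rewrite sum_nat_const_nat; lia.
- by move=> ns ->; rewrite /I EG.
Qed.

Lemma runs_degree h t a p b np c q pq m (v : 'I_n) :
  (forall u : 'I_n, m (v * n + u) = (u \in nbh e v) :> nat) ->
  runs w degree_loop (NState (file h t a p b v np 0 0 c q pq) m) (18 * n + 5)
    (fun ns => ns = NState (file h t a p b v np n (dfc e set0 v) c q pq) m).
Proof.
move=> mv; pose I j ns := ns = NState (file h t a p b v np j (order (upto (nbh e v) j)) c q pq) m.
have nB : n * n + n + 10 < B by move: B_mem; lia.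
apply: (runs_weaken (T := \sum_(0 <= j < n) (9 + 9) + 5) (Q := I n)) => //.
- apply: (runs_for_ord BE (I := I)) => //.
  + lia.
  + by rewrite /I upto0 /order cards0.
  + by move=> j ns ->.
  move=> i ns ->; have vi := matrix_index v i; have v_n := ltn_ord v; have i_n := ltn_ord i.
  have oA := cardn (upto (nbh e v) i).
  apply: (runs_assign BE) => /=; rewrite mv; first by fits; case: (i \in _); lia.
  split=> //; rewrite /I uptoS; case: (boolP (i \in nbh e v)) => iv; last by rewrite addn0.
  by rewrite /order cardsU1 inE ltnn andbF addnC.
- by rewrite sum_nat_const_nat; lia.
- by move=> ns ->; rewrite /I upton /dfc setD0.
Qed.

Lemma runs_rows h t a p b np u x c q pq m :
  (forall v u : 'I_n, m (v * n + u) = e v u :> nat) -> (forall z, n * n <= z -> m z = 0) ->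
  runs w row_loop (NState (file h t a p b 0 np u x c q pq) m) (n * (18 * n + 34) + 5)
    (fun ns => exists u' x' m',
      [/\ ns = NState (file h t a p b n np u' x' c q pq) m', matrix_at m'
        & record_at m' (address 0) set0 0]).
Proof.
move=> mE mZ.
(* Rows below [j] have their diagonal set already. The last clause preserves size, parent and marks
   of record 0, whose initial zeros describe the empty set. *)
pose I j ns := exists u' x' m',
      [/\ ns = NState (file h t a p b j np u' x' c q pq) m',
          forall v y : 'I_n, m' (v * n + y) = if v < j then y \in nbh e v else e v y,
          forall v : 'I_n, v < j -> m' (n * n + n + v + 2) = dfc e set0 v
        & forall z, n * n <= z -> z < n * n + n + 2 -> m' z = 0].
have nB : n * n + 2 * n + 12 < B by move: B_mem; rewrite mulSn; lia.
apply: (runs_weaken (T := \sum_(0 <= j < n) (18 * n + 25 + 9) + 5) (Q := I n)) => //.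
- apply: (runs_for_ord BE (I := I)) => //.
  + lia.
  + by exists u, x, m; split=> // z hz _; apply: mZ.
  + by move=> j ns [u' [x' [m' [-> _ _ _]]]].
  move=> v ns [u' [x' [m' [-> mM mD mZ']]]]; have v_n := ltn_ord v.
  have vv := matrix_index v v; have dn := dfc_le set0 v.
  have [d Ed] : exists d, dfc e set0 v = d by eexists.
  rewrite Ed in dn.
  apply: (runs_weaken (T := 7 + (2 + (2 + (18 * n + 5 + 9)))) (Q := _)); [|by lia|by move=> ?; apply].
  apply: runs_seq; apply: (runs_write BE) => /=; [by fits|by fits|].
  set m1 := nupd _ _ _.
  have m1v (y : 'I_n) : m1 (v * n + y) = (y \in nbh e v) :> nat.
    rewrite /m1 /nupd mM ltnn inE; have [->|yv] := eqVneq y v; first by rewrite eqxx.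
    have {}yv : y != v :> nat by rewrite (inj_eq val_inj).
    by case: eqP => //; lia.
  apply: runs_seq; apply: (runs_assign BE) => /=; first by fits.
  apply: runs_seq; apply: (runs_assign BE) => /=; first by fits.
  apply: runs_seq; apply: runs_weaken; [exact: runs_degree m1v|exact: leqnn|].
  move=> ns1 ->; rewrite Ed; apply: (runs_write BE) => /=; [by fits|by fits|].
  split=> //; do 2 eexists; eexists; split; [by reflexivity| | |].
  + move=> i y; have iy := matrix_index i y; updates.
    have [->|iv] := eqVneq i v; first by rewrite ltnSn m1v.
    have {}iv' : i != v :> nat by rewrite (inj_eq val_inj).
    rewrite ltnS leq_eqVlt (negPf iv') /= -mM /m1 /nupd; case: eqP => // /matrix_index_inj [E _].
    by rewrite E eqxx in iv.
  + move=> i; rewrite ltnS leq_eqVlt => /orP[/eqP/val_inj ->|iv]; first by rewrite /nupd eqxx Ed.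
    by rewrite /m1; updates; apply: mD.
  + by move=> z z1 z2; rewrite /m1; updates; apply: mZ'.
- by rewrite sum_nat_const_nat; lia.
move=> ns [u' [x' [m' [-> mM mD mZ']]]]; exists u', x', m'; split=> //.
  by move=> i y; rewrite mM ltn_ord.
rewrite /address mul0n addn0; split.
- by rewrite /order cards0 mZ' //; lia.
- by rewrite mZ' //; lia.
- by move=> y; have yn := ltn_ord y; rewrite mZ' ?inE //; lia.
- by move=> y; apply: mD.
Qed.

Definition setup_time := 13 * k + n * (18 * n + 34) + 28.

Lemma runs_setup m :
  (forall v u : 'I_n, m (v * n + u) = e v u :> nat) -> (forall z, n * n <= z -> m z = 0) ->
  runs w setup (NState [:: n; k; 0; 0; 0; 0; 0; 0; 0; 0; 0; 0; 0; 0; 0; 0; 0] m) setup_time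
    (fun ns => exists u x m',
      [/\ ns = NState (file 0 1 0 0 0 n 0 u x 0 0 0) m', matrix_at m'
        & record_at m' (address 0) set0 0]).
Proof.
move=> mE mZ; have nB : n * n + 2 * n + 12 < B by move: B_mem; rewrite mulSn; lia.
have kB : k.+1 + 1024 * G < B by move: k_G B_cnt; lia.
apply: (runs_weaken (T := 4 + (6 + (2 + (13 * k + 5 + (4 + (n * (18 * n + 34) + 5 + 2)))))) (Q := _));
  [|by rewrite /setup_time; lia|by move=> ?; apply].
apply: runs_seq; apply: (runs_assign BE) => /=; first by fits.
apply: runs_seq; apply: (runs_assign BE) => /=; first by fits.
apply: runs_seq; apply: (runs_assign BE) => /=; first by fits.
apply: runs_seq; apply: runs_weaken; [exact: runs_pow|exact: leqnn|].
move=> ns ->; apply: runs_seq; apply: (runs_assign BE) => /=; first by fits.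
rewrite addn1; apply: runs_seq.
apply: runs_weaken; [exact: runs_rows mE mZ|exact: leqnn|].
move=> ns1 [u [x [m' [-> mA m0]]]]; apply: (runs_assign BE) => /=; first by fits.
by exists u, x, m'.
Qed.

Definition main_time := setup_time + search_time + output_time + 35.

Lemma runs_main m :
  (forall v u : 'I_n, m (v * n + u) = e v u :> nat) -> (forall z, n * n <= z -> m z = 0) ->
  runs w main (NState [:: n; k; 0; 0; 0; 0; 0; 0; 0; 0; 0; 0; 0; 0; 0; 0; 0] m) main_time
    (fun ns =>
      (nth 0 (nregs ns) 0 = 1 /\ exists L : seq (seq 'I_n),
        [/\ all uniq L, leads e k set0 [seq [set i in l] | l <- L]
          & stores (nmem ns) (nth 0 (nregs ns) 1) (size L :: bag_codes L)]) \/
      (nth 0 (nregs ns) 0 = 0 /\ ~ feasible)).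
Proof.
move=> mE mZ.
apply: (runs_weaken (T := setup_time + (search_time + (1 + 1 + (output_time + 29)).+1)) (Q := _));
  [|by rewrite /main_time; lia|by move=> ?; apply].
apply: runs_seq; apply: runs_weaken; [exact: runs_setup mE mZ|exact: leqnn|].
move=> ns [u [x [m1 [-> mA m0]]]].
apply: runs_seq; apply: runs_weaken; [exact: runs_search mA m0|exact: leqnn|].
move=> ns1 [h [a [p [b [v [np [u1 [x1 [c [q [pq [m2 [S [-> mS vS ans]]]]]]]]]]]]]].
have SB := tail_bound (valid_size vS).
have aB : a < B.
  by case: posnP ans => [->|_ [aS _]]; [lia|apply: ltn_trans aS _; lia].
apply: (runs_if BE (T := output_time + 29)) => /=; [by fits|by fits| |].
- rewrite leqn0 => a0; rewrite a0 in ans.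
  apply: (runs_weaken (T := 2) (Q := _)); [|by lia|by move=> ?; apply].
  by apply: (runs_assign BE) => /=; [fits; lia|right].
- rewrite lt0n => /negPf a0; rewrite a0 in ans; case: ans => aS aT.
  by apply: runs_weaken; [exact: runs_output mS vS aS erefl aT|exact: leqnn|left].
Qed.

End Spec.

(** * Word length, running time and the actual input *)

Lemma abs_le_klogk (k : int) : `|k|%N <= (klogk k).+1.
Proof.
rewrite /klogk; case: (ltnP 1 `|k|%N) => k1; last by lia.
by apply: leqW; rewrite leq_pmulr // up_log_gt0.
Qed.

Lemma word_abs (k : int) w : klogk k < w -> word w k.
Proof.
move=> kw; apply: leq_ltn_trans (abs_le_klogk k) _.
by apply: leq_trans (ltn_expl _ (ltnSn 1)) _; rewrite leq_exp2l.
Qed.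

Lemma expn_up_log n : n.+1 <= 2 ^ (up_log 2 n).+1.
Proof. 
case: n => [|n]; first by rewrite expn_gt0.
have := up_logP n.+1 (ltnSn 1); rewrite expnS; lia.
Qed.

(** [main] is reserved for [0 < n] and [0 <= k]. Without vertices the empty sequence, of width -1,
    is a solution iff [-1 <= k]; with vertices no decomposition has negative width. *)
Definition program : cmd :=
  If (Reg 0) (cst 0)
    (If (Const (Negz 0)) (Reg 1) (Assign 1 (cst 0) ;; Assign 0 (cst 1)) (Assign 0 (cst 0)))
    (If (cst 0) (Reg 1) main (Assign 0 (cst 0))).

(** For [a = up_log 2 n] and [b = klogk k] both quantities are polynomial in [n] and [G], so their
    logarithms are linear in [a + b + 1]; the factor 40 absorbs the constants. *)
Lemma memory_bounds n K a b c G :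
  n.+1 <= 2 ^ a.+1 -> K <= b.+1 -> G = 2 ^ (10 * K) -> 40 <= c ->
  n * n + (n.+1 * G).+1 * (2 * n + 2) + n * n.+1 + 10 < 2 ^ (c * (a + b + 1)) /\
  (n.+1 * G).+1 * G.+1 + 1024 * G < 2 ^ (c * (a + b + 1)).
Proof.
move=> na Kb EG c40.
have G1 : G.+1 <= 2 ^ (10 * b + 11).
  have h : 2 ^ (10 * K) <= 2 ^ (10 * b + 10) by rewrite leq_exp2l //; lia.
  rewrite addnS expnS EG; have := expn_gt0 2 (10 * K); lia.
have w40 : 2 ^ (40 * (a + b + 1)) <= 2 ^ (c * (a + b + 1)) by rewrite leq_exp2l // leq_mul2r c40 orbT.
have main x y z t : x <= 2 ^ y -> z + y < t -> t <= 40 * (a + b + 1) -> 2 ^ z * x < 2 ^ (c * (a + b + 1)).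
  move=> xy yt t40; apply: leq_trans w40; apply: leq_ltn_trans (_ : 2 ^ (z + y) < _).
    by rewrite expnD leq_mul2l xy orbT.
  by rewrite ltn_exp2l //; lia.
pose P := n.+1 * n.+1 * G.+1; pose Q := n.+1 * G.+1 * G.+1.
split.
- apply: leq_ltn_trans (main P (a.+1 + a.+1 + (10 * b + 11)) 4 (2 * a + 10 * b + 18) _ _ _).
  + have p1 : n * n <= P by rewrite -[n * n]muln1 !leq_mul.
    have p2 : (n.+1 * G).+1 * n.+1 <= P.
      by rewrite /P mulnAC leq_mul2r mulnS addSn ltnS leq_addl.
    have p3 : n * n.+1 <= P by rewrite -[n * n.+1]muln1 !leq_mul.
    have p4 : 0 < P by [].
    have -> : (n.+1 * G).+1 * (2 * n + 2) = 2 * ((n.+1 * G).+1 * n.+1).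
      by rewrite mulnCA; congr (_ * _); rewrite mulnS addnC.
    rewrite (_ : 2 ^ 4 = 16) //; move: P (n * n) (n * n.+1) (_ * n.+1) p1 p2 p3 p4 => *; lia.
  + by rewrite /P (expnD 2 _ (10 * b + 11)) (expnD 2 a.+1) !leq_mul.
  + lia.
  + lia.
- apply: leq_ltn_trans (main Q (a.+1 + (10 * b + 11) + (10 * b + 11)) 11 (a + 20 * b + 40) _ _ _).
  + have p1 : (n.+1 * G).+1 * G.+1 <= Q by rewrite leq_mul2r mulnS addSn ltnS leq_addl.
    have p2 : G <= Q.
      by apply: leq_trans (leqnSn G) _; rewrite /Q -mulnA mulnCA leq_pmulr.
    rewrite (_ : 2 ^ 11 = 2 * 1024); last by rewrite expnS.
    move: Q (_ * G.+1) p1 p2 => *; lia.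
  + by rewrite /Q (expnD 2 _ (10 * b + 11)) (expnD 2 a.+1) !leq_mul.
  + lia.
  + lia.
Qed.

(** At most [(n + 1) G] records are visited, each with [O(K)] expansions of time [O(n G)]; with
    [K < G] this gives at most [2 ^ 12 * n ^ 2 * G ^ 3]. From [K <= b.+1] follows
    [G ^ 3 <= 2 ^ 30 * 2 ^ (30 b)], and the two constants multiply to [2 ^ 42]. *)
Lemma time_bound n K b c G :
  0 < n -> K <= b.+1 -> G = 2 ^ (10 * K) -> 2 ^ 42 <= c ->
  main_time n K G + 6 <= c * (2 ^ (c * b) * n ^ 2 + 1).
Proof.
move=> n0 Kb EG c42; have G0 : 0 < G by rewrite EG expn_gt0.
have KG : K.+1 <= G.
  by rewrite EG; apply: leq_trans (ltn_expl K (ltnSn 1)) _; rewrite leq_exp2l // leq_pmull.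
have nG : n <= n * G by rewrite leq_pmulr.
have E1 : expand_time n K G <= 291 * (n * G).
  have h1 : K.+1 * (32 * n + 14) <= G * (46 * n) by apply: leq_mul => //; lia.
  have h2 : n.+1 * G <= 2 * n * G by rewrite leq_mul2r; apply/orP; right; lia.
  have h3 : G * (24 * n + 20) <= G * (44 * n) by rewrite leq_mul2l; apply/orP; right; lia.
  rewrite /expand_time; move: (n.+1 * G) (K.+1 * _) (G * (24 * n + 20)) h1 h2 h3 => *; lia.
have G2 : n * G <= n * G * G by rewrite leq_pmulr.
have E2 : visit_time n K G + 9 <= 974 * (n * G * G).
  have h1 : (3 * K + 2) * expand_time n K G <= 3 * G * (291 * (n * G)) by apply: leq_mul => //; lia.
  rewrite /visit_time; move: (_ * expand_time n K G) h1 => *; lia.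
have G3 : n * G * G <= n * n * (G * G * G).
  by rewrite -mulnA leq_mul ?leq_pmulr // leq_pmulr.
set M := n * n * (G * G * G) in G3.
have E3 : search_time n K G <= 1948 * M + 5.
  rewrite /search_time leq_add2r; apply: leq_trans (_ : 2 * n * G * (974 * (n * G * G)) <= _).
    by rewrite leq_mul // leq_mul2r; apply/orP; right; lia.
  by rewrite /M; lia.
have nM : n * n <= M by rewrite leq_pmulr // !muln_gt0 G0.
have KM : K <= M by apply: leq_trans G3; apply: leq_trans (ltnW KG) _; rewrite leq_pmull // muln_gt0 n0.
have n2 : n <= n * n by rewrite leq_pmulr.
have E4 : main_time n K G + 6 <= 2 ^ 12 * M.
  rewrite (_ : 2 ^ 12 = 4 * 1024); last by rewrite (expnD 2 2 10).
  rewrite /main_time /setup_time /output_time.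
  move: M (search_time n K G) E3 nM KM {G3} => *; lia.
have EM : M <= 2 ^ 30 * (2 ^ (c * b) * n ^ 2).
  rewrite mulnA -expnD -(mulnn n) /M mulnC leq_mul2r; apply/orP; right.
  rewrite EG -!expnD leq_exp2l //.
  have c30 : 30 <= c by apply: leq_trans c42; apply: leq_trans (_ : 2 ^ 5 <= _); rewrite ?leq_exp2l.
  have : 30 * b <= c * b by rewrite leq_mul2r c30 orbT.
  lia.
apply: leq_trans E4 _; apply: leq_trans (leq_mul (leqnn _) EM) _.
by rewrite mulnA -expnD leq_mul // leq_addr.
Qed.

Lemma width_ge_m1 (V : finType) (D : seq {set V}) : (-1 <= width D)%R.
Proof. by rewrite /width; lia. Qed.

Lemma width_ge0 n (e : rel 'I_n) D : 0 < n -> path_decomposition e D -> (0 <= width D)%R.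
Proof.
move=> n0 [cov _ _]; have : Ordinal n0 \in [set: 'I_n] by rewrite inE.
rewrite -cov bigcup_seq => /bigcupP[W WD oW].
have W0 : 0 < #|W| by apply/card_gt0P; exists (Ordinal n0).
rewrite /width subr_ge0 lez_nat; apply: leq_trans W0 _.
exact: (@leq_bigmax_seq _ D xpredT (fun W : {set 'I_n} => #|W|)).
Qed.

Definition input_memory n (e : rel 'I_n) (z : nat) : nat :=
  [exists i : 'I_n, exists j : 'I_n, (z == i * n + j) && e i j].

Lemma input_memoryE n (e : rel 'I_n) (v u : 'I_n) : input_memory e (v * n + u) = e v u :> nat.
Proof.
congr nat_of_bool; apply/existsP/idP => [[i /existsP[j /andP[/eqP E eij]]]|evu].
  by have [-> ->] := matrix_index_inj E.
by exists v; apply/existsP; exists u; rewrite eqxx.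
Qed.

Lemma input_memory0 n (e : rel 'I_n) z : n * n <= z -> input_memory e z = 0.
Proof.
rewrite /input_memory => nz; case: existsP => // -[i /existsP[j /andP[/eqP E _]]].
by move: nz; rewrite E leqNgt matrix_index.
Qed.

Lemma simulates_input n (e : rel 'I_n) (K : nat) :
  simulates (input e K%:Z)
    (NState [:: n; K; 0; 0; 0; 0; 0; 0; 0; 0; 0; 0; 0; 0; 0; 0; 0] (input_memory e)).
Proof.
split=> [i|z] /=; first by do 17 (case: i => [|i] //=); rewrite !nth_nil.
rewrite /input_memory.
have -> : [exists i : 'I_n, exists j : 'I_n, (z%:Z == (i * n + j)%N%:Z)%R && e i j] =
          [exists i : 'I_n, exists j : 'I_n, (z == i * n + j) && e i j].
  by apply: eq_existsb => i; apply: eq_existsb => j; rewrite eqz_nat.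
by case: ifP.
Qed.

Theorem theorem33 :
  exists (p : cmd) (c : nat),
    forall (n : nat) (e : rel 'I_n) (k : int),
      irreflexive e -> semi_complete e ->
      exists (t : nat) (s : state),
        [/\ exec (c * (up_log 2 n + klogk k + 1)) p (input e k) t s,
            t <= c * (2 ^ (c * klogk k) * n ^ 2 + 1)
          & correct_answer e k s].
Proof.
(* [c] is known only through this inequality, so the unary number [2 ^ 42] is never unfolded. *)
have [c c42] : exists c, 2 ^ 42 <= c by eexists; apply: leqnn.
have c40 : 40 <= c by apply: leq_trans c42; apply: leq_trans (_ : 2 ^ 6 <= _); rewrite ?leq_exp2l.
exists program, c => n e k _ sc; set w := c * _.
have kw : word w k by apply: word_abs; rewrite /w; nia.
have nw : word w n%:Z%R.
  rewrite /word /=; apply: leq_trans (expn_up_log n) _; rewrite leq_exp2l // /w; nia.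
have w1 : 1 < 2 ^ w by rewrite -[1](expn0 2) ltn_exp2l // /w; nia.
have w0 : 0 < 2 ^ w := ltnW w1.
have small t : t <= 40 -> t <= c * (2 ^ (c * klogk k) * n ^ 2 + 1).
  by move=> t40; apply: leq_trans (leq_trans t40 c40) _; rewrite leq_pmulr // addn1.
case: (posnP n) => [n0|n0].
  have n0' : (n%:Z <= 0)%R by lia.
  have no (x : 'I_n) : False by have := ltn_ord x; lia.
  case: (boolP (-1 <= k)%R) => k1.
    do 2 eexists; split.
    - apply: exec_if; rewrite /= ?nw /word ?w0 // n0' /=.
      apply: exec_if; rewrite /= /word ?w1 -?/(word w k) ?kw //= k1.
      apply: exec_seq; apply: exec_assign => /=; rewrite /word ?w0 ?w1 //.
    - exact: small.
    (* With [n = 0] all memory cells are 0, so address 0 already encodes the sequence without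
       bags. *)
    - left; split=> //; exists [::]; split.
      + exists [::]; split=> // -[] // _ /=; case: ifP => // /existsP[i].
        by case: (no i).
      + split=> [||u]; [|by []|by case: (no u)].
        by rewrite big_nil; apply/setP => x; case: (no x).
      + by rewrite /width big_nil sub0r.
  do 2 eexists; split.
  - apply: exec_if; rewrite /= ?nw /word ?w0 // n0' /=.
    apply: exec_if; rewrite /= /word ?w1 -?/(word w k) ?kw //= (negPf k1).
    by apply: exec_assign => /=; rewrite /word w0.
  - exact: small.
  - right; split=> // -[D [_ Dk]]; move/negP: k1; apply.
    exact: le_trans (width_ge_m1 D) Dk.
have n0' : (n%:Z <= 0)%R = false by lia.
case: k => [K|K] in w kw nw w1 w0 small *; last first.
  do 2 eexists; split.
  - apply: exec_if; rewrite /= ?nw /word ?w0 // n0'.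
    apply: exec_if; rewrite /= /word ?w0 -?/(word w (Negz K)) ?kw //=.
    by apply: exec_assign => /=; rewrite /word w0.
  - exact: small.
  - right; split=> // -[D [pD Dk]]; by have := le_trans (width_ge0 n0 pD) Dk.
have Kb : K <= (klogk K).+1 := abs_le_klogk K.
have [B1 B2] := memory_bounds (expn_up_log n) Kb erefl c40.
have KG : K < 2 ^ (10 * K).
  by apply: leq_trans (ltn_expl K (ltnSn 1)) _; rewrite leq_exp2l // leq_pmull.
have G0 : 0 < 2 ^ (10 * K) by rewrite expn_gt0.
have [t [s [ns [ex [sr sm] tT ans]]]] :=
  runs_main erefl n0 G0 B1 B2 KG erefl sc (input_memoryE e) (@input_memory0 n e) (simulates_input e K).
(* The two tests in front of [main] cost 3 units each, the 6 added in [time_bound]. *)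
exists (1 + 1 + (1 + 1 + t).+1).+1, s; split.
- apply: exec_if; rewrite /= ?nw /word ?w0 // n0'.
  by apply: exec_if; rewrite /= /word ?w0 -?/(word w K) ?kw.
- by apply: leq_trans (time_bound n0 Kb erefl c42); move: tT; lia.
case: ans => [[r0 [L [uL ld st]]]|[r0 nf]]; last first.
  right; rewrite sr r0; split=> // -[D [pD /width_leP wD]].
  by apply: nf; exists D.
left; rewrite sr r0; split=> //; exists [seq [set x in b] | b <- L]; split.
- by exists L; split=> // i iL; rewrite sr -PoszD sm st.
- exact: leads_path_decomposition ld.
- by apply/width_leP => W; apply: leads_card ld.
Qed.
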